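(* Suppose $\mathcal{R}=(\Omega,\mathcal{F},\mathbb P,\sigma,X,\mathcal L)$ and $\mathcal{R}_k=(\Omega,\mathcal{F},\mathbb P,\sigma,X,\mathcal L_k)$, $k\geq 1$, are strongly measurable separable linear random dynamical systems with a common ergodic invertible base satisfying conditions (H0)–(H3) below. Assume $1\in X$. Assume that $\mathcal{R}$ splits (i.e. has an Oseledets splitting) with respect to $|\cdot|$ and $\dim E_1=1$. Then $\mathcal{R}$ has a unique random acim, $F$. For sufficiently large $k$, there is a unique random acim for $\mathcal{R}_k$, denoted $F_k$. Furthermore, $\lim_{k\to\infty}F_k=F$ fibrewise in $|\cdot|$; that is, for $\mathbb P$-a.e. $\omega\in\Omega$, $\lim_{k\to\infty}|f_\omega-f_{k,\omega}|=0$.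
   Context: Let $(Y,|\cdot|)$ and $(X,\|\cdot\|)$ be Banach spaces with a compact embedding $X\hookrightarrow Y$ and a continuous embedding $Y\hookrightarrow L^1(\mathrm{Leb})$ (functions on an interval $I$, $m$ = normalized Lebesgue measure). A random dynamical system $(\Omega,\mathcal F,\mathbb P,\sigma,X,\mathcal L)$ consists of a Lebesgue probability space, an invertible ergodic $\mathbb P$-preserving $\sigma$, a separable Banach space $X$ and a strongly measurable map $\omega\mapsto\mathcal L_\omega$ into bounded linear operators on $X$; write $\mathcal L^{(n)}_\omega=\mathcal L_{\sigma^{n-1}\omega}\circ\cdots\circ\mathcal L_\omega$. A function $f:\Omega\to\mathbb R$ is tempered if $\lim_{n\to\pm\infty}\frac1{|n|}\log|f(\sigma^n\omega)|=0$ for a.e. $\omega$. The system splits (has an Oseledets splitting) if there is a measurable equivariant decomposition $X=V(\omega)\oplus\bigoplus_{j}E_j(\omega)$ into closed subspaces, with $E_j(\omega)$ finite-dimensional spaces on which vectors grow at the exceptional Lyapunov exponents $\lambda_1>\lambda_2>\dots$ (exponents exceeding the index of compactness), $V(\omega)$ having growth rate at most the index of compactness, and tempered projections; $E_1(\omega)$ is the top Oseledets space. The hypotheses are: (H0) $\int\log^+\|\mathcal L\|\,d\mathbb P<\infty$ and $\int\log^+\|\mathcal L_k\|\,d\mathbb P<\infty$ for every $k$; for every $k$, $f\in X$ and a.e. $\omega$, $\mathcal L_{k,\omega}$ and $\mathcal L_\omega$ preserve the cone of non-negative functions and $\int\mathcal L_{k,\omega}f\,dm=\int f\,dm=\int\mathcal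 L_\omega f\,dm$. (H1) There exist a constant $B>0$ and measurable $\alpha:\Omega\to\mathbb R_+$ with $\int\log\alpha\,d\mathbb P<0$ such that $\|\mathcal L_{k,\omega}f\|\leq\alpha(\omega)\|f\|+B|f|$ for all $f\in X$, $k\in\mathbb N$ and a.e. $\omega$. (H2) For a.e. $\omega$, $C(\omega):=\sup_{k,n\in\mathbb N}|\mathcal L^{(n)}_{k,\sigma^{-n}\omega}|$ (operator norm with respect to $|\cdot|$) is well defined and $C$ is tempered. (H3) There exist $\tau_k\to0$ such that for a.e. $\omega$, $\sup_{\|g\|=1}|(\mathcal L_\omega-\mathcal L_{k,\omega})g|\leq\tau_k$. For $G:\Omega\times I\to\mathbb R$ with $g_\omega=G(\omega,\cdot)\in X$, define $\mathcal L^nG(\omega,\cdot):=\mathcal L^{(n)}_{\sigma^{-n}\omega}g_{\sigma^{-n}\omega}$ (similarly $\mathcal L^n_k$). A random acim for $\mathcal L$ (or $\mathcal L_k$) is a non-negative fixed point $F$, fibrewise normalized in $L^1(\mathrm{Leb})$, with $\omega\mapsto f_\omega:=F(\omega,\cdot)$ measurable into $(X,\text{Borel})$. *)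

(* Defs.v *)
From HB Require Import structures.
From mathcomp Require Import all_boot all_order all_algebra.
From mathcomp Require Import all_classical all_reals all_analysis.
Set Implicit Arguments. Unset Strict Implicit. Unset Printing Implicit Defensive.
Import Order.TTheory GRing.Theory Num.Theory.
Import numFieldNormedType.Exports.
Local Open Scope classical_set_scope.
Local Open Scope ring_scope.

Section RDS.
Context {R : realType}.

Definition elog (x : \bar R) : \bar R :=
  match x with
  | EFin r => if (0 < r)%R then (ln r)%:E else -oo
  | +oo => +oo
  | -oo => -oo
  end%E.

Definition logplus (x : R) : R := Num.max (ln x) 0.

Definition rate (u : nat -> \bar R) : nat -> \bar R :=
  fun n => (elog (u n) * (n%:R^-1)%:E)%E.

Context {d : measure_display} {Om : measurableType d}.
Variable P : probability Om R.

Definition ergodic_invertible_base (s sinv : Om -> Om) :=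
  [/\ cancel s sinv /\ cancel sinv s,
      measurable_fun setT s, measurable_fun setT sinv,
      (forall A, measurable A -> P (s @^-1` A) = P A) &
      (forall A, measurable A -> s @^-1` A = A -> P A = 0%E \/ P A = 1%E)].

(** (Om, F, P) is a Lebesgue (standard) probability space: complete, and
    isomorphic mod 0 (via an injective measurable map onto a Borel subset of R)
    to a Borel probability space on R. *)
Definition lebesgue_space :=
  (forall A N : set Om, measurable N -> P N = 0%E -> A `<=` N -> measurable A) /\
  exists (phi : Om -> R) (O : set Om),
    [/\ measurable O /\ P O = 1%E, measurable_fun setT phi, set_inj O phi,
        measurable (phi @` O) &
        forall A, measurable A -> exists B : set R, measurable B /\
          P ((A `\` phi @^-1` B) `|` (phi @^-1` B `\` A)) = 0%E].

Definition tempered (s sinv : Om -> Om) (f : Om -> R) :=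
  {ae P, forall w,
     (rate (fun n => `|f (iter n s w)|%:E) @ \oo --> 0%E) /\
     (rate (fun n => `|f (iter n sinv w)|%:E) @ \oo --> 0%E)}.

Variable X : completeNormedModType R.

Definition lin (T : X -> X) :=
  forall (a : R) (u v : X), T (a *: u + v) = a *: T u + T v.

Definition opnorm (nrm : X -> R) (T : X -> X) : \bar R :=
  ereal_sup [set (nrm (T f))%:E | f in [set f | nrm f <= 1]].

Definition ind_compact (nrm : X -> R) (T : X -> X) : \bar R :=
  ereal_inf [set r%:E | r in [set r : R | 0 < r /\
     exists s : seq X, forall f, nrm f <= 1 ->
       exists2 c, c \in s & nrm (T f - c) <= r]].

Definition borel_meas (g : Om -> X) :=
  forall U : set X, open U -> measurable (g @^-1` U).

Definition strongly_meas (L : Om -> X -> X) :=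
  forall f : X, borel_meas (fun w => L w f).

Definition separable_space := exists u : nat -> X, dense (range u).

Fixpoint cocycle (L : Om -> X -> X) (s : Om -> Om) (n : nat) (w : Om) : X -> X :=
  match n with
  | 0 => id
  | n'.+1 => L (iter n' s w) \o cocycle L s n' w
  end.

Definition linear_rds (L : Om -> X -> X) :=
  [/\ separable_space, strongly_meas L,
      forall w, lin (L w) &
      forall w, opnorm (fun f : X => `|f|) (L w) \is a fin_num].

Definition dim_eq (E : set X) (n : nat) :=
  exists v : 'I_n -> X,
    E = [set \sum_(i < n) c i *: v i | c in [set: 'I_n -> R]] /\
    (forall c : 'I_n -> R, \sum_(i < n) c i *: v i = 0 -> forall i, c i = 0).

Definition is_subspace (E : set X) :=
  E 0 /\ forall (a : R) u v, E u -> E v -> E (a *: u + v).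

(** index j (0-based) is an exceptional exponent when there are l of them
    (l = None : infinitely many) *)
Definition valid_idx (l : option nat) (j : nat) :=
  if l is Some n then (j < n)%N else true.

(** cuts J at which a decomposition X = E_0 + ... + E_{J-1} + V_J is required *)
Definition valid_cut (l : option nat) (J : nat) :=
  if l is Some n then J = n else True.

(** Oseledets splitting of (s, L) with respect to the norm nrm, with data:
    kappa  : index of compactness (a.e. constant),
    l      : number of exceptional Lyapunov exponents (None = countably many),
    lam j  : the (j+1)-th exceptional exponent,
    E j w  : the Oseledets space E_{j+1}(w), with dimension dE j,
    PE j w : the projection onto E_{j+1}(w) along the complementary spaces,
    V J w  : the complementary space after the first J Oseledets spaces,
    PV J w : the projection onto V J w along E_1 + ... + E_J. *)
Definition oseledets_splitting (nrm : X -> R) (s : Om -> Om) (sinv : Om -> Om)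
    (L : Om -> X -> X) (kappa : \bar R) (l : option nat) (lam : nat -> R)
    (dE : nat -> nat)
    (E : nat -> Om -> set X) (PE : nat -> Om -> X -> X)
    (V : nat -> Om -> set X) (PV : nat -> Om -> X -> X) :=
  [/\
      {ae P, forall w,
         rate (fun n => ind_compact nrm (cocycle L s n w)) @ \oo --> kappa},
      (forall j, valid_idx l j -> (kappa < (lam j)%:E)%E /\
          (valid_idx l j.+1 -> lam j.+1 < lam j)),
      (forall j, valid_idx l j ->
         [/\ {ae P, forall w, dim_eq (E j w) (dE j) /\ closed (E j w)},
             {ae P, forall w, L w @` E j w = E j (s w)},
             {ae P, forall w, forall v, E j w v -> v != 0 ->
                rate (fun n => (nrm (cocycle L s n w v))%:E) @ \oo --> (lam j)%:E},
             strongly_meas (PE j) /\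
             tempered s sinv (fun w => fine (opnorm nrm (PE j w))) &
             {ae P, forall w, lin (PE j w) /\ range (PE j w) = E j w}]),
      (forall J, valid_cut l J ->
         [/\ {ae P, forall w, is_subspace (V J w) /\ closed (V J w)},
             {ae P, forall w, L w @` V J w `<=` V J (s w)},
             {ae P, forall w, forall v, V J w v ->
                (limn_esup (rate (fun n => (nrm (cocycle L s n w v))%:E))
                   <= (if valid_idx l J then (lam J)%:E else kappa))%E},
             strongly_meas (PV J) /\
             tempered s sinv (fun w => fine (opnorm nrm (PV J w))) &
             {ae P, forall w, lin (PV J w) /\ range (PV J w) = V J w}]) &
      (forall J, valid_cut l J -> {ae P, forall w,
         (forall f, f = \sum_(j < J) PE j w f + PV J w f) /\
         (forall (e : nat -> X) (v : X), (forall j, (j < J)%N -> E j w (e j)) ->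
            V J w v -> \sum_(j < J) e j + v = 0 ->
            v = 0 /\ forall j, (j < J)%N -> e j = 0)})].

Definition splits_dimE1_one nrm s sinv L :=
  exists kappa l lam dE E PE V PV,
    @oseledets_splitting nrm s sinv L kappa l lam dE E PE V PV /\
    valid_idx l 0 /\ dE 0%N = 1%N.

End RDS.

Section FunctionSpaces.
Context {R : realType}.
Local Notation leb := (@lebesgue_measure R).

Definition Iab (a b : R) : set R := [set x | a <= x <= b].

Definition intm (a b : R) (g : R -> R) : R :=
  fine (\int[leb]_(x in Iab a b) (g x)%:E)%E / (b - a).

Definition nonneg_fun (a b : R) (g : R -> R) :=
  {ae leb, forall x, Iab a b x -> 0 <= g x}.

(** Setup: I = [a,b]; (X, ||.||) and (Y, |.|) Banach spaces; jXY : X -> Y a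
    compact (linear, injective) embedding; evY : Y -> functions on I a
    continuous linear embedding of Y into L^1(Leb on I). *)
Definition function_space_setup (a b : R) (X Y : completeNormedModType R)
    (jXY : X -> Y) (evY : Y -> R -> R) :=
  [/\ a < b,
      (forall (c : R) u v, jXY (c *: u + v) = c *: jXY u + jXY v) /\ injective jXY,
      compact (closure (jXY @` [set f | `|f| <= 1])),
      (forall (c : R) u v x, evY (c *: u + v) x = c * evY u x + evY v x) /\
      (forall y, leb.-integrable (Iab a b) (fun x => (evY y x)%:E)) /\
      (exists C : R, forall y,
         (\int[leb]_(x in Iab a b) `|evY y x|%:E <= (C * `|y|)%:E)%E) &
      (forall y, {ae leb, forall x, Iab a b x -> evY y x = 0} -> y = 0)].

Context {d : measure_display} {Om : measurableType d}.
Variable P : probability Om R.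
Variable X : completeNormedModType R.

(** a random acim for L: a measurable, fibrewise non-negative, normalized,
    fixed point of the transfer operator (L F)(w) = L_{s^{-1} w} f_{s^{-1} w} *)
Definition random_acim (a b : R) (ev : X -> R -> R) (sinv : Om -> Om)
    (L : Om -> X -> X) (F : Om -> X) :=
  borel_meas F /\
  {ae P, forall w, [/\ nonneg_fun a b (ev (F w)),
                       intm a b (ev (F w)) = 1 &
                       L (sinv w) (F (sinv w)) = F w]}.

End FunctionSpaces.

Definition evX {R : realType} {X Y : completeNormedModType R}
  (jXY : X -> Y) (evY : Y -> R -> R) (f : X) : R -> R := evY (jXY f).
Definition weak_norm {R : realType} {X Y : completeNormedModType R}
  (jXY : X -> Y) (f : X) : R := `|jXY f|.

(* Main.v *)
(** A recurrence principle drives the proof: a measurable set that almost every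
    orbit visits only finitely often is null, and by ergodicity a non-null set is
    visited infinitely often, forwards and backwards.

    Write |.| for the weak norm and ||.|| for the strong one.  Letting k tend to
    infinity in (H2) and (H3) bounds the weak norm of L^(n) by the tempered function
    C, so the top exponent is at most 0 and every vector in the complement of E_1
    decays to 0 in |.|.  Since L preserves integrals, this complement is exactly the
    kernel of the integral, and F(w) := the projection of 1 onto E_1(w) is
    equivariant with integral 1.  Its negative part tends to 0 along forward orbits
    (compare F with L^(n) 1 >= 0), hence vanishes by recurrence.  Uniqueness follows
    in the same way.

    For L_k, the maximal ergodic inequality applied to log alpha and the
    Lasota-Yorke inequality give a finite bound D(w), uniform in k and n, on the
    strong norm of L_k^(n) arriving in the fibre of w.  Compactness of the embedding
    turns the pointwise decay of L on mean-zero functions into decay uniform on the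
    strong unit ball, which (H3) transfers to L_k for k large: there is a non-null
    set A, with D <= M on A, from which L_k^(N) contracts mean-zero functions by
    1/(2M) in the strong norm.  Between two visits to A the strong norm grows by at
    most M, so every backward visit to A gains a factor 1/2.  Therefore
    L_k^(n) 1, started in the fibre of s^-n w, is a Cauchy sequence, its limit F_k is
    the unique acim, and ||F_k(w)|| <= D(w) ||1||.  Finally
    limsup_k |F_k - F|, restricted to a set where C is bounded, tends to 0 along
    forward orbits and vanishes by recurrence. *)

Require Import Defs.
From HB Require Import structures.
From mathcomp Require Import all_boot all_order all_algebra.
From mathcomp Require Import all_classical all_reals all_analysis.
From mathcomp Require Import measurable_realfun ring lra.
Set Implicit Arguments. Unset Strict Implicit. Unset Printing Implicit Defensive.
Import Order.TTheory GRing.Theory Num.Theory.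
Import numFieldNormedType.Exports.
Local Open Scope classical_set_scope.
Local Open Scope ring_scope.

(** * Recurrence and the maximal ergodic inequality *)

Lemma nat_gt {R : realType} (x : R) : exists n : nat, x < n%:R.
Proof. by exists (Num.truncn x).+1; exact: truncnS_gt. Qed.

(** * Measurability of sets cut out by countably many conditions *)

Section MeasurableSets.
Context {R : realType} {d : measure_display} {Om : measurableType d}.

Lemma mset_forall (Q : nat -> Om -> Prop) :
  (forall n, measurable [set w | Q n w]) -> measurable [set w | forall n, Q n w].
Proof.
move=> mQ; have -> : [set w | forall n, Q n w] = \bigcap_n [set w | Q n w].
  by apply/seteqP; split=> w /= Qw n; [move=> _; exact: Qw | exact: Qw].
exact: bigcapT_measurable.
Qed.

Lemma mset_exists (Q : nat -> Om -> Prop) :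
  (forall n, measurable [set w | Q n w]) -> measurable [set w | exists n, Q n w].
Proof.
move=> mQ; have -> : [set w | exists n, Q n w] = \bigcup_n [set w | Q n w].
  by apply/seteqP; split=> w /= [n]; [move=> Qw; exists n | move=> _ Qw; exists n].
exact: bigcupT_measurable.
Qed.

Lemma mset_not (Q : Om -> Prop) :
  measurable [set w | Q w] -> measurable [set w | ~ Q w].
Proof. exact: measurableC. Qed.

Lemma mset_and (Q Q' : Om -> Prop) :
  measurable [set w | Q w] -> measurable [set w | Q' w] ->
  measurable [set w | Q w /\ Q' w].
Proof. exact: measurableI. Qed.

Lemma mset_cstP (q : Prop) : measurable [set w : Om | q].
Proof.
have [qT|qF] := pselect q.
  have -> : [set _ : Om | q] = setT by apply/seteqP; split.
  exact: measurableT.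
have -> : [set _ : Om | q] = set0 by apply/seteqP; split.
exact: measurable0.
Qed.

Lemma mset_imply (b : bool) (Q : Om -> Prop) :
  measurable [set w | Q w] -> measurable [set w | b -> Q w].
Proof.
case: b => mQ.
  have -> : [set w | true -> Q w] = [set w | Q w] by apply/seteqP; split=> w //= /(_ isT).
  exact: mQ.
have -> : [set w | false -> Q w] = setT by apply/seteqP; split.
exact: measurableT.
Qed.

Lemma mset_lt (f g : Om -> R) :
  measurable_fun setT f -> measurable_fun setT g -> measurable [set w | f w < g w].
Proof.
move=> mf mg; have -> : [set w | f w < g w] = setT `&` (fun w => f w < g w) @^-1` [set true].
  by rewrite setTI.
exact: measurable_fun_ltr.
Qed.

Lemma mset_le (f g : Om -> R) :
  measurable_fun setT f -> measurable_fun setT g -> measurable [set w | f w <= g w].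
Proof.
move=> mf mg; have -> : [set w | f w <= g w] = setT `&` (fun w => f w <= g w) @^-1` [set true].
  by rewrite setTI.
exact: measurable_fun_ler.
Qed.

Lemma measurable_pos_indic (f : Om -> R) :
  measurable_fun setT f -> measurable_fun setT (fun w => (0 < f w)%R%:R : R).
Proof.
move=> mf; have -> : (fun w => (0 < f w)%R%:R) = \1_[set w | 0 < f w] :> (Om -> R).
  apply/funext => w; rewrite indicE; have [fw|fw] := boolP (0 < f w).
    by rewrite mem_set.
  by rewrite memNset //=; exact/negP.
apply: measurable_indic; apply: mset_lt => //; exact: measurable_cst.
Qed.

Lemma measurable_fun_lt (f : Om -> R) :
  (forall c, measurable [set w | f w < c]) -> measurable_fun setT f.
Proof.
move=> mf; apply: (@measurability _ _ Om (measurableTypeR R) setT f _ (RGenInftyO.measurableE R)).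
move=> _ [_ [c ->] <-]; rewrite setTI.
have -> : f @^-1` `]-oo, c[ = [set w | f w < c] by apply/seteqP; split=> w /=; rewrite in_itv.
exact: mf.
Qed.

End MeasurableSets.

Section MeasurePreserving.
Context {R : realType} {d : measure_display} {Om : measurableType d}.
Variable P : probability Om R.

(** Countable subadditivity. It replaces an almost surely finite random quantity by a constant, on a
    smaller set that is still non-null. *)
Lemma pos_cover (S : set Om) (Q : nat -> Om -> Prop) :
  measurable S -> P S <> 0%E -> (forall n, measurable [set w | Q n w]) ->
  {ae P, forall w, S w -> exists n, Q n w} ->
  exists n, P (S `&` [set w | Q n w]) <> 0%E.
Proof.
move=> mS PS mQ aeQ; apply: contrapT => /forallNP PQ; apply: PS.
have negl : P.-negligible (\bigcup_n (S `&` [set w | Q n w])).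
  apply: negligible_bigcup => n; apply/negligibleP; first exact: measurableI.
  exact: contrapT (PQ n).
apply/negligibleP => //; apply: negligibleS (negligibleU negl aeQ) => w Sw.
have [[n Qn]|nQ] := pselect (exists n, Q n w); first by left; exists n.
by right=> /= /(_ Sw).
Qed.

Lemma ae_set1 (A : set Om) : measurable A -> P A = 1%E -> {ae P, forall w, A w}.
Proof.
move=> mA PA; apply/negligibleP; first exact: measurableC.
have -> : [set x | A x] = A by [].
by apply: etrans (probability_setC P mA) _; rewrite PA subee.
Qed.

Variable T : Om -> Om.
Hypothesis mT : measurable_fun setT T.
Hypothesis PT : forall A, measurable A -> P (T @^-1` A) = P A.

Lemma measurable_iter n : measurable_fun setT (iter n T).
Proof. by elim: n => [|n IHn]; [exact: measurable_id | exact: measurableT_comp]. Qed.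

Lemma measurable_preiter n (Q : Om -> Prop) :
  measurable [set w | Q w] -> measurable [set w | Q (iter n T w)].
Proof.
by move=> mQ; rewrite -[X in measurable X]setTI; apply: (measurable_iter n) mQ.
Qed.

Lemma preserving_iter n (A : set Om) :
  measurable A -> P ((iter n T) @^-1` A) = P A.
Proof.
move=> mA; elim: n => [//|n IHn].
have -> : iter n.+1 T @^-1` A = T @^-1` (iter n T @^-1` A).
  by apply/seteqP; split=> w; rewrite /preimage /= -iterS iterSr.
by rewrite PT //; exact: (measurable_preiter n (Q := A)).
Qed.

Lemma ae_iter (Q : Om -> Prop) :
  {ae P, forall w, Q w} -> {ae P, forall w, forall n, Q (iter n T w)}.
Proof.
move=> [N [mN PN QN]]; apply: ae_foralln => n; exists (iter n T @^-1` N); split.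
- exact: (measurable_preiter n (Q := N)).
- exact: etrans (preserving_iter n mN) _.
- by move=> w nQ; apply: QN.
Qed.

(** The points that avoid [A] from time [N] on form an increasing sequence [B N] with union of full
    measure. Each [B N] lies in the [N]-th preimage of the complement of [A], so by invariance that
    complement has measure 1. *)
Lemma null_of_finite_visits (A : set Om) : measurable A ->
  {ae P, forall w, exists N, forall n, ~ A (iter (N + n) T w)} -> P A = 0%E.
Proof.
move=> mA finA.
pose B N := [set w | forall n, ~ A (iter (N + n) T w)].
have mB N : measurable (B N).
  by apply: mset_forall => n; apply: mset_not; apply: (measurable_preiter _ (Q := A)).
have mUB : measurable (\bigcup_N B N) by exact: bigcupT_measurable.
have ndB : nondecreasing_seq B.
  move=> i j ij; apply/subsetPset => w Bw n.
  by rewrite -(subnKC ij) -addnA; exact: Bw.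
have PUB : P (\bigcup_N B N) = 1%E.
  have : P (~` \bigcup_N B N) = 0%E.
    apply/negligibleP; first exact: measurableC.
    by apply: negligibleS finA => w /= nB [N BN]; apply: nB; exists N.
  rewrite probability_setC // => /eqP; rewrite sube_eq ?fin_num_measure //.
  by rewrite add0e eq_sym => /eqP.
have leB N : (P (B N) <= P (~` A))%E.
  rewrite -(preserving_iter N (measurableC mA)); apply: le_measure; rewrite ?inE //.
    by apply: (measurable_preiter N (Q := ~` A)); exact: measurableC.
  by move=> w /(_ 0%N); rewrite addn0.
have : (1 <= P (~` A))%E.
  rewrite -PUB -(cvg_lim _ (nondecreasing_cvg_mu mB mUB ndB)) //.
  apply: lime_le; last exact: nearW.
  by apply/cvg_ex; eexists; exact: nondecreasing_cvg_mu.
rewrite probability_setC // => h; apply/eqP; rewrite eq_le measure_ge0 andbT.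
have fA : P A \is a fin_num by exact: fin_num_measure.
by move: h; rewrite -(fineK fA) -EFinB !lee_fin; lra.
Qed.

Hypothesis ergT : forall A, measurable A -> T @^-1` A = A -> P A = 0%E \/ P A = 1%E.

(** The set of points with infinitely many visits is exactly invariant, hence null or of full
    measure; if it were null, [null_of_finite_visits] would make [A] null. *)
Lemma infinite_visits (A : set Om) : measurable A -> P A <> 0%E ->
  {ae P, forall w, forall N, exists n, A (iter (N + n) T w)}.
Proof.
move=> mA PA; pose I := [set w | forall N, exists n, A (iter (N + n) T w)].
have mI : measurable I.
  apply: mset_forall => N; apply: mset_exists => n.
  exact: (measurable_preiter _ (Q := A)).
have invI : T @^-1` I = I.
  apply/seteqP; split=> w /= h N.
    by have [n] := h N; rewrite -iterSr -addnS => ?; exists n.+1.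
  by have [n] := h N.+1; rewrite addSn iterSr; exists n.
have [I0|] := ergT mI invI; last exact: ae_set1.
case: PA; apply: null_of_finite_visits => //.
have : {ae P, forall w, ~ I w}.
  apply/negligibleP; first by apply: measurableC; exact: measurableC.
  by have -> : ~` [set x | ~ I x] = I by rewrite -[RHS]setCK.
apply: filterS => w /existsNP[N /forallNP nA]; by exists N.
Qed.

(** The maximum of the Birkhoff sums of lengths 0 to [n], as a recursion along [T] from which
    Garsia's inequality can be read off. *)
Fixpoint maxsum (g : Om -> R) (n : nat) (w : Om) : R :=
  if n is n'.+1 then Num.max 0 (g w + maxsum g n' (T w)) else 0.

Lemma maxsum_ge0 g n w : 0 <= maxsum g n w.
Proof. by case: n => //= n; rewrite le_max lexx. Qed.

Lemma maxsum_le g n w : maxsum g n w <= maxsum g n.+1 w.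
Proof.
elim: n w => [|n IHn] w; first exact: maxsum_ge0.
rewrite [leLHS]/= [leRHS]/=.
by apply: le_max2 => //; rewrite lerD2l; exact: IHn.
Qed.

Lemma sum_le_maxsum g n w : \sum_(i < n) g (iter i T w) <= maxsum g n w.
Proof.
elim: n w => [|n IHn] w; first by rewrite big_ord0.
rewrite big_ord_recl /= le_max; apply/orP; right; rewrite lerD2l.
apply: le_trans (IHn (T w)); rewrite le_eqVlt; apply/orP; left; apply/eqP.
by apply: eq_bigr => i _; rewrite /= -iterS iterSr.
Qed.

Lemma measurable_maxsum g n : measurable_fun setT g -> measurable_fun setT (maxsum g n).
Proof.
move=> mg; elim: n => [|n IHn]; first exact: measurable_cst.
apply: measurable_maxr; first exact: measurable_cst.
by apply: measurable_funD => //; exact: (measurableT_comp IHn mT).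
Qed.

Lemma ge0_integral_preserving (f : Om -> R) :
  measurable_fun setT f -> (forall w, 0 <= f w) ->
  (\int[P]_w (f (T w))%:E = \int[P]_w (f w)%:E)%E.
Proof.
move=> mf f0; have mEf : measurable_fun setT (EFin \o f) by exact/measurable_EFinP.
have := @ge0_integral_pushforward _ _ Om Om R T mT P setT (EFin \o f) measurableT mEf.
rewrite preimage_setT => <-; last by move=> y _; rewrite lee_fin.
apply: eq_measure_integral => A mA _; exact: PT.
Qed.

Lemma integrable_maxsum g n : P.-integrable setT (EFin \o g) ->
  P.-integrable setT (EFin \o maxsum g n).
Proof.
move=> ig; have mg : measurable_fun setT g by apply/measurable_EFinP; exact: measurable_int ig.
elim: n => [|n IHn]; first exact: finite_measure_integrable_cst.
have iT : P.-integrable setT (EFin \o (fun w => maxsum g n (T w))).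
  apply/integrableP; split.
    by apply/measurable_EFinP; apply: (measurableT_comp _ mT); exact: measurable_maxsum.
  under eq_integral do rewrite /= ger0_norm ?maxsum_ge0 //.
  rewrite (ge0_integral_preserving (measurable_maxsum n mg)) //.
    exact: (integrable_lty measurableT IHn).
  by move=> w; exact: maxsum_ge0.
apply: (le_integrable measurableT _ _ (integrableD measurableT (integrable_abse ig) iT)).
  by apply/measurable_EFinP; exact: (measurable_maxsum n.+1).
move=> w _; rewrite [X in (_ <= X)%E]gee0_abs /=; last first.
  by rewrite -EFinD lee_fin addr_ge0 // maxsum_ge0.
rewrite lee_fin ger0_norm ?le_max ?lexx // ge_max addr_ge0 ?maxsum_ge0 //=.
by rewrite lerD2r ler_norm.
Qed.

(* Garsia: [g >= maxsum g n - maxsum g n \o T] wherever [maxsum g n > 0]. *)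
Lemma maximal_ergodic g n : P.-integrable setT (EFin \o g) ->
  (0 <= \int[P]_w (g w * (0 < maxsum g n w)%R%:R)%R%:E)%E.
Proof.
move=> ig; have mg : measurable_fun setT g by apply/measurable_EFinP; exact: measurable_int ig.
have mM := measurable_maxsum n mg.
set M := maxsum g n.
have iM : P.-integrable setT (EFin \o M) by exact: integrable_maxsum.
have intMT : (\int[P]_w (M (T w))%:E = \int[P]_w (M w)%:E)%E.
  by apply: ge0_integral_preserving => // w; exact: maxsum_ge0.
have iMT : P.-integrable setT (EFin \o (fun w => M (T w))).
  apply/integrableP; split; first by apply/measurable_EFinP; exact: (measurableT_comp mM mT).
  under eq_integral do rewrite /= ger0_norm ?maxsum_ge0 //.
  by rewrite intMT; exact: (integrable_lty measurableT iM).
have ih : P.-integrable setT (EFin \o (fun w => g w * (0 < M w)%R%:R)).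
  apply: (le_integrable measurableT _ _ ig).
    apply/measurable_EFinP; apply: measurable_funM => //.
    exact: measurable_pos_indic.
  by move=> w _ /=; rewrite lee_fin normrM; case: (0 < M w); rewrite ?normr1 ?mulr1 // normr0 mulr0.
have : (\int[P]_w (M w)%:E <= \int[P]_w ((g w * (0 < M w)%R%:R)%R%:E + (M (T w))%:E))%E.
  apply: le_integral => //; first exact: (integrableD measurableT ih iMT).
  move=> w _; rewrite -EFinD lee_fin.
  have [Mw|Mw] := ltP 0 (M w); last by rewrite mulr0 add0r (le_trans Mw) // maxsum_ge0.
  rewrite mulr1; move: Mw; rewrite /M; case: n {mM M iM intMT iMT ih} => [|n].
    by rewrite ltxx.
  move=> Mw; have := maxsum_le g n (T w); move: Mw; rewrite [maxsum g n.+1 w]/=.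
  by rewrite lt_max ltxx /= => Mw le_n; rewrite (max_idPr (ltW Mw)) lerD2l.
rewrite (@integralD _ _ _ P _ measurableT _ _ ih iMT) intMT.
have fM : (\int[P]_w (M w)%:E \is a fin_num)%E by exact: integrable_fin_num iM.
by rewrite -leeBlDr // subee.
Qed.

(** The set [Z] where [maxsum] is unbounded in [n] is invariant. If it had full measure, the
    indicators of [0 < maxsum g n] would tend to 1 almost surely, and dominated convergence would
    turn [maximal_ergodic] into a non-negative integral of [g]. *)
Lemma bounded_birkhoff_sums g : P.-integrable setT (EFin \o g) ->
  (\int[P]_w (g w)%:E < 0)%E ->
  {ae P, forall w, exists K : nat, forall n, \sum_(i < n) g (iter i T w) <= K%:R}.
Proof.
move=> ig intg; have mg : measurable_fun setT g by apply/measurable_EFinP; exact: measurable_int ig.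
pose Z := [set w | forall K : nat, exists n, K%:R < maxsum g n w].
have mZ : measurable Z.
  apply: mset_forall => K; apply: mset_exists => n.
  by apply: mset_lt; [exact: measurable_cst | exact: measurable_maxsum].
have invZ : T @^-1` Z = Z.
  apply/seteqP; split=> w /= h K.
    have [K' hK'] := nat_gt (`|g w|).
    have [n hn] := h (K + K')%N; exists n.+1; rewrite /= lt_max; apply/orP; right.
    have := hK'; have := ler_norm (- g w); rewrite normrN; move: hn; rewrite natrD; lra.
  have [K' hK'] := nat_gt (`|g w|).
  have [[|n] hn] := h (K + K')%N.
    by move: hn => /=; rewrite ltNge ler0n.
  exists n; move: hn; rewrite /= lt_max => /orP[|]; first by rewrite ltNge ler0n.
  have := hK'; have := ler_norm (g w); rewrite natrD; lra.
have [Z0|Z1] := ergT mZ invZ.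
  have : {ae P, forall w, ~ Z w}.
    apply/negligibleP; first by apply: measurableC; exact: measurableC.
    by have -> : ~` [set x | ~ Z x] = Z by rewrite -[RHS]setCK.
  apply: filterS => w /existsNP[K /forallNP nA]; exists K => n.
  by apply: le_trans (sum_le_maxsum g n w) _; rewrite leNgt; apply/negP.
exfalso; have aeZ := ae_set1 mZ Z1.
pose h n w := g w * (0 < maxsum g n w)%R%:R.
have mh n : measurable_fun setT (EFin \o h n).
  apply/measurable_EFinP; apply: measurable_funM => //.
  by apply: measurable_pos_indic; exact: measurable_maxsum.
have mEg : measurable_fun setT (EFin \o g) by exact/measurable_EFinP.
have [||_ _] := @dominated_convergence _ _ R P setT measurableT
  (fun n => EFin \o h n) (EFin \o g) (abse \o (EFin \o g)) mh mEg _ (integrable_abse ig).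
- apply: filterS aeZ => w Zw _; have [n0 hn0] := Zw 0%N.
  apply: cvg_near_cst; exists n0 => // n /= n0n; rewrite /h.
  suff -> : 0 < maxsum g n w by rewrite mulr1.
  apply: lt_le_trans hn0 _; rewrite -(subnKC n0n); elim: (n - n0)%N => [|m IHm].
    by rewrite addn0.
  by rewrite addnS (le_trans IHm) // maxsum_le.
- apply: aeW => w n _ /=; rewrite lee_fin /h normrM.
  by case: (0 < _); rewrite ?normr1 ?mulr1 // normr0 mulr0.
move=> cvgh; move: intg; rewrite ltNge => /negP; apply.
rewrite -(cvg_lim _ cvgh) //; apply: lime_ge; first by apply/cvg_ex; eexists; exact: cvgh.
by apply: nearW => n; exact: maximal_ergodic.
Qed.

End MeasurePreserving.

(** * Exponential decay of the products of alpha *)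

Section ContractingProducts.
Context {R : realType} {d : measure_display} {Om : measurableType d}.
Variable P : probability Om R.
Variable alpha : Om -> R.
Hypothesis malpha : measurable_fun setT alpha.
Hypothesis alpha0 : forall w, 0 <= alpha w.
Hypothesis intp : (\int[P]_w (logplus (alpha w))%:E < +oo)%E.
Hypothesis intn : (\int[P]_w elog (alpha w)%:E < 0)%E.

(** The cut at [-m] makes the logarithm integrable even if [alpha] vanishes on a non-null set or
    [log alpha] has integral [-oo]. *)
Definition trunc_log (m : nat) (w : Om) : R := ln (Num.max (alpha w) (expR (- m%:R))).

Let max_gt0 m w : 0 < Num.max (alpha w) (expR (- m%:R)).
Proof. by rewrite lt_max expR_gt0 orbT. Qed.

Lemma measurable_trunc_log m : measurable_fun setT (trunc_log m).
Proof.
apply: (measurableT_comp (@measurable_ln R)).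
by apply: measurable_maxr => //; exact: measurable_cst.
Qed.

Lemma measurable_logplus : measurable_fun setT (fun w => logplus (alpha w)).
Proof.
apply: measurable_maxr; last exact: measurable_cst.
exact: (measurableT_comp (@measurable_ln R)).
Qed.

Lemma trunc_log_pos m w : Num.max (trunc_log m w) 0 = logplus (alpha w).
Proof.
have e1 : expR (- m%:R) <= 1 :> R by rewrite -expR0 ler_expR oppr_le0.
rewrite /trunc_log /logplus; have [am|am] := leP (expR (- m%:R)) (alpha w) => //.
rewrite expRK max_r ?oppr_le0 // max_r //; have [a0|a0] := leP (alpha w) 0.
  by rewrite ln0.
by rewrite -ln1 ler_ln ?posrE // ltW // (lt_le_trans am).
Qed.

Let neg m w : R := Num.max (- trunc_log m w) 0.

Let trunc_logE m w : trunc_log m w = logplus (alpha w) - neg m w.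
Proof. by rewrite -(trunc_log_pos m) /neg; case: (leP (trunc_log m w) 0);
  case: (leP (- trunc_log m w) 0); lra. Qed.

Let neg_ge0 m w : 0 <= neg m w. Proof. by rewrite le_max lexx orbT. Qed.

Let neg_le m w : neg m w <= m%:R.
Proof.
rewrite ge_max ler0n andbT lerNl -[leLHS](@expRK R) ler_ln ?posrE ?expR_gt0 //.
by rewrite le_max lexx orbT.
Qed.

Let measurable_neg m : measurable_fun setT (neg m).
Proof.
apply: measurable_maxr; last exact: measurable_cst.
by apply: measurable_funN; exact: measurable_trunc_log.
Qed.

Let integrable_logplus : P.-integrable setT (EFin \o (fun w => logplus (alpha w))).
Proof.
apply/integrableP; split; first by apply/measurable_EFinP; exact: measurable_logplus.
under eq_integral do rewrite /= ger0_norm ?le_max ?lexx ?orbT //.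
exact: intp.
Qed.

Let integrable_neg m : P.-integrable setT (EFin \o neg m).
Proof.
apply: (le_integrable measurableT _ _ (finite_measure_integrable_cst P m%:R measurableT)).
  by apply/measurable_EFinP; exact: measurable_neg.
by move=> w _ /=; rewrite lee_fin !ger0_norm.
Qed.

Lemma integrable_trunc_log m : P.-integrable setT (EFin \o trunc_log m).
Proof.
have -> : EFin \o trunc_log m =
    ((EFin \o (fun w => logplus (alpha w))) \- (EFin \o neg m))%E.
  by apply/funext => w /=; rewrite trunc_logE EFinB.
exact: integrableB.
Qed.

(** The functions [neg m] increase to the negative part of [elog alpha]. If no truncation had a
    negative integral, each [neg m] would have integral at most that of [logplus alpha], and
    monotone convergence would contradict [intn]. *)
Lemma integral_trunc_log_lt0 : exists m, (\int[P]_w (trunc_log m w)%:E < 0)%E.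
Proof.
apply: contrapT => /forallNP ge0.
have elogp w : ((fun w => elog (alpha w)%:E)^\+ w)%E = (logplus (alpha w))%:E.
  rewrite funeposE /elog /logplus /=; case: ifPn => [a0|]; first by rewrite -EFin_max.
  by rewrite -leNgt => a0; rewrite ln0 // maxxx maxNye.
have cvgneg w : (neg m w)%:E @[m --> \oo] --> ((fun w => elog (alpha w)%:E)^\- w)%E.
  rewrite funenegE /elog /=; case: ifPn => [a0|].
    rewrite -EFinN -EFin_max; apply: cvg_near_cst.
    have [m0 hm0] := nat_gt (- ln (alpha w)); exists m0 => // m /= m0m.
    have em : expR (- m%:R) <= alpha w.
      rewrite -[leRHS](lnK (x := alpha w)) ?posrE // ler_expR lerNl.
      by rewrite (le_trans (ltW hm0)) // ler_nat.
    by rewrite /neg /trunc_log (max_l em).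
  rewrite -leNgt => a0; have {}a0 : alpha w = 0 by apply/eqP; rewrite eq_le a0 alpha0.
  (* At a zero of [alpha] the logarithm is [-oo] and [neg m w] equals [m], so the limit is [+oo]. *)
  rewrite /= maxye; apply/cvgeryP/cvgryPge => A.
  have [m0 hm0] := nat_gt A; exists m0 => // m /= m0m.
  rewrite /neg /trunc_log a0 (max_r (expR_ge0 _)) expRK opprK le_max.
  by rewrite (le_trans (ltW hm0)) ?ler_nat.
have nd w : setT w -> {homo (fun m => (neg m w)%:E) : m n / (m <= n)%N >-> (m <= n)%E}.
  move=> _ m n mn; rewrite lee_fin; apply: le_max2 => //.
  rewrite lerN2 ler_ln ?posrE ?max_gt0 //; apply: le_max2 => //.
  by rewrite ler_expR lerN2 ler_nat.
have mc := @cvg_monotone_convergence _ Om R P setT measurableT (fun m => EFin \o neg m).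
have {mc} := mc _ _ nd.
move=> /(_ (fun m => (measurable_EFinP _ _).2 (measurable_neg m)))
  /(_ (fun m w _ => neg_ge0 m w)).
have -> : (\int[P]_w limn ((fun m => EFin \o neg m)^~ w) =
           \int[P]_w ((fun w => elog (alpha w)%:E)^\- w))%E.
  by apply: eq_integral => w _; exact: cvg_lim (cvgneg w).
move=> mc; have le_neg : (\int[P]_w ((fun w => elog (alpha w)%:E)^\- w) <=
    \int[P]_w (logplus (alpha w))%:E)%E.
  rewrite -(cvg_lim _ mc) //; apply: lime_le; first by apply/cvg_ex; eexists; exact: mc.
  apply: nearW => m; have /negP := ge0 m; rewrite -leNgt.
  have -> : (\int[P]_w (trunc_log m w)%:E =
      \int[P]_w ((logplus (alpha w))%:E - (neg m w)%:E))%E.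
    by apply: eq_integral => w _; rewrite trunc_logE EFinB.
  rewrite (@integralB _ _ _ P _ measurableT _ _ integrable_logplus (integrable_neg m)).
  by rewrite sube_ge0 // (integrable_fin_num measurableT (integrable_neg m)).
move: intn; rewrite integralE ltNge => /negP; apply.
under eq_integral do rewrite elogp.
rewrite sube_ge0 // (integrable_fin_num measurableT integrable_logplus) //.
by rewrite orbT.
Qed.

Variable T : Om -> Om.
Hypothesis mT : measurable_fun setT T.
Hypothesis PT : forall A, measurable A -> P (T @^-1` A) = P A.
Hypothesis ergT : forall A, measurable A -> T @^-1` A = A -> P A = 0%E \/ P A = 1%E.

(** With [c] half the absolute value of a negative truncated integral, [trunc_log m + c] still has
    negative integral, so its Birkhoff sums are bounded above; exponentiation gives the products. *)
Lemma contracting_products : exists2 c : R, 0 < c &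
  {ae P, forall w, exists K : R, forall n,
     \prod_(i < n) alpha (iter i T w) <= K * expR (- (c * n%:R))}.
Proof.
have [m intm] := integral_trunc_log_lt0.
have il := integrable_trunc_log m.
have fl := integrable_fin_num measurableT il.
pose c := - (fine (\int[P]_w (trunc_log m w)%:E)) / 2.
have c0 : 0 < c.
  by rewrite divr_gt0 // oppr_gt0 -lte_fin fineK.
exists c => //.
have ic := finite_measure_integrable_cst P c measurableT.
have ig : P.-integrable setT (EFin \o (fun w => trunc_log m w + c)).
  exact: (integrableD measurableT il ic).
have intg : (\int[P]_w (trunc_log m w + c)%:E < 0)%E.
  under eq_integral do rewrite EFinD.
  rewrite (@integralD _ _ _ P _ measurableT _ _ il ic).
  have -> : (\int[P]_x (EFin \o cst c) x = c%:E)%E.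
    apply: etrans (integral_cst P measurableT c%:E) _; rewrite -[RHS]mule1.
    by congr (_ * _)%E; exact: probability_setT.
  rewrite -(fineK fl) -EFinD lte_fin; move: c0; rewrite /c; lra.
apply: filterS (bounded_birkhoff_sums mT PT ergT ig intg) => w [K hK].
exists (expR K%:R) => n.
have hK' : \sum_(i < n) trunc_log m (iter i T w) <= K%:R - c * n%:R.
  by have := hK n; rewrite big_split /= sumr_const card_ord -mulr_natr; lra.
rewrite -expRD; apply: le_trans (_ : expR (\sum_(i < n) trunc_log m (iter i T w)) <= _).
  rewrite expR_sum; apply: ler_prod => i _; rewrite alpha0 /= lnK ?posrE //.
  by rewrite le_max lexx.
by rewrite ler_expR.
Qed.

End ContractingProducts.

(** * Measurability of Banach-valued maps *)

Section LinearMaps.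
Context {R : realType} {X : completeNormedModType R}.

Lemma lin0 (T : X -> X) : lin T -> T 0 = 0.
Proof.
move=> linT; have := linT 1 0 0; rewrite !scale1r !addr0 => /esym/eqP.
by rewrite -subr_eq0 addrK => /eqP.
Qed.

Lemma linD (T : X -> X) f g : lin T -> T (f + g) = T f + T g.
Proof. by move=> linT; have := linT 1 f g; rewrite !scale1r. Qed.

Lemma linZ (T : X -> X) a f : lin T -> T (a *: f) = a *: T f.
Proof. by move=> linT; have := linT a f 0; rewrite (lin0 linT) !addr0. Qed.

Lemma linB (T : X -> X) f g : lin T -> T (f - g) = T f - T g.
Proof. by move=> linT; rewrite linD // -scaleN1r linZ // scaleN1r. Qed.

Definition bounded_op (T : X -> X) := exists c : R, forall f, `|T f| <= c * `|f|.

Lemma opnorm_fin_bounded (T : X -> X) : lin T ->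
  opnorm (fun f : X => `|f|) T \is a fin_num -> bounded_op T.
Proof.
move=> linT finT; exists (fine (opnorm (fun f : X => `|f|) T)) => f.
have [->|f0] := eqVneq f 0; first by rewrite lin0 // normr0 mulr0.
have nf : 0 < `|f| by rewrite normr_gt0.
have : (`|T (`|f|^-1 *: f)|%R%:E <= opnorm (fun f : X => `|f|%R) T)%E.
  apply: ereal_sup_ubound; exists (`|f|^-1 *: f) => //=.
  by rewrite normrZ normfV normr_id mulVf ?gt_eqF.
rewrite -(fineK finT) lee_fin linZ // normrZ normfV normr_id.
by rewrite ler_pdivrMl // mulrC.
Qed.

Lemma continuous_of_lipschitz (phi : X -> R) (c : R) :
  (forall f g, phi f <= phi g + c * `|f - g|) -> continuous phi.
Proof.
move=> lip f; apply/cvgrPdist_lt => e e0.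
have c1 : 0 < `|c| + 1 by rewrite ltr_wpDl.
near=> g; have dfg : `|f - g| < e / (`|c| + 1).
  by near: g; apply: cvgr_dist_lt => //; rewrite divr_gt0.
have lec : c * `|f - g| <= (`|c| + 1) * `|f - g|.
  by rewrite ler_wpM2r // (le_trans (ler_norm c)) // lerDl.
have {dfg} : (`|c| + 1) * `|f - g| < e by rewrite mulrC -ltr_pdivlMr.
have := lip f g; have := lip g f; rewrite [`|g - f|]distrC.
by rewrite ltr_norml; move=> *; apply/andP; split; lra.
Unshelve. all: by end_near. Qed.

Lemma bounded_op_continuous (T : X -> X) : lin T -> bounded_op T -> continuous T.
Proof.
move=> linT [c hc] f; apply/cvgrPdist_lt => e e0.
have c1 : 0 < `|c| + 1 by rewrite ltr_wpDl.
near=> g; have dfg : `|f - g| < e / (`|c| + 1).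
  by near: g; apply: cvgr_dist_lt => //; rewrite divr_gt0.
rewrite -linB //; apply: le_lt_trans (hc _) _.
apply: le_lt_trans (_ : _ <= (`|c| + 1) * `|f - g|) _; last by rewrite mulrC -ltr_pdivlMr.
by rewrite ler_wpM2r // (le_trans (ler_norm c)) // lerDl.
Unshelve. all: by end_near. Qed.

Lemma dense_near (u : nat -> X) (f : X) (e : R) :
  dense (range u) -> 0 < e -> exists i, `|f - u i| < e.
Proof.
move=> du e0; have [] := du (ball f e).
- by exists f; exact: ballxx.
- exact: ball_open.
by move=> _ [] /[swap] [[i _ <-]]; rewrite -ball_normE /= => ?; exists i.
Qed.

Lemma le_of_dense (u : nat -> X) (phi psi : X -> R) :
  dense (range u) -> continuous phi -> continuous psi ->
  (forall i, phi (u i) <= psi (u i)) -> forall f, phi f <= psi f.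
Proof.
move=> du cphi cpsi le_u f; rewrite leNgt; apply/negP => lt_f.
pose e := (phi f - psi f) / 2; have e0 : 0 < e by rewrite divr_gt0 // subr_gt0.
have : \forall g \near f, `|phi f - phi g| < e /\ `|psi f - psi g| < e.
  have /cvgrPdist_lt/(_ e e0) nphi := cphi f.
  have /cvgrPdist_lt/(_ e e0) npsi := cpsi f.
  by apply: filterS2 nphi npsi => g.
move=> /nbhs_ballP[r r0 hr].
have [i hi] := dense_near f du r0.
have [] := hr (u i); first by rewrite -ball_normE.
have he : e * 2 = phi f - psi f by rewrite /e divfK.
have h1 := le_u i; rewrite !ltr_norml => /andP[h2 h3] /andP[h4 h5].
by clearbody e; lra.
Qed.

End LinearMaps.

Section BorelMeas.
Context {R : realType} {d : measure_display} {Om : measurableType d}.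
Context {X : completeNormedModType R}.

Lemma borel_continuous (phi : X -> R) (g : Om -> X) :
  continuous phi -> borel_meas g -> measurable_fun setT (fun w => phi (g w)).
Proof.
move=> cphi mg; apply: measurable_fun_lt => c.
apply: (mg [set x | phi x < c]).
by move/continuousP : cphi => /(_ _ (open_lt (y := c))).
Qed.

Lemma borel_norm (g : Om -> X) v :
  borel_meas g -> measurable_fun setT (fun w => `|g w - v|).
Proof.
apply: (borel_continuous (phi := fun x => `|x - v|)).
apply: (@continuous_of_lipschitz _ _ _ 1) => f h; rewrite mul1r [leRHS]addrC.
exact: ler_distD.
Qed.

Lemma borel_comp (g : Om -> X) (T : Om -> Om) :
  borel_meas g -> measurable_fun setT T -> borel_meas (fun w => g (T w)).
Proof.
by move=> mg mT U oU; rewrite -[X in measurable X]setTI; exact: (mT measurableT _ (mg U oU)).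
Qed.

Lemma borel_if (A : set Om) (g h : Om -> X) :
  measurable A -> borel_meas g -> borel_meas h ->
  borel_meas (fun w => if `[< A w >] then g w else h w).
Proof.
move=> mA mg mh U oU.
have -> : (fun w => if `[< A w >] then g w else h w) @^-1` U =
    (A `&` g @^-1` U) `|` (~` A `&` h @^-1` U).
  apply/seteqP; split=> w; rewrite /preimage /=.
    by case: asboolP => Aw ?; [left|right].
  by case=> -[Aw ?]; case: asboolP.
by apply: measurableU; apply: measurableI => //; [exact: mg | exact: measurableC | exact: mh].
Qed.

Variable u : nat -> X.
Hypothesis du : dense (range u).

(** By separability an open set is a countable union of balls with centres [u i] and radii
    [1/(m+1)]. *)
Lemma borel_of_norm (g : Om -> X) :
  (forall i, measurable_fun setT (fun w => `|g w - u i|)) -> borel_meas g.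
Proof.
move=> mg U oU.
have -> : g @^-1` U = [set w | exists i, exists m : nat,
    (forall y, `|y - u i| < m.+1%:R^-1 -> U y) /\ `|g w - u i| < m.+1%:R^-1].
  apply/seteqP; split=> w; last by move=> [i [m [hU hw]]]; exact: hU.
  rewrite /preimage /= => Ug; have /nbhs_ballP[r r0 hr] := open_nbhs_nbhs (conj oU Ug).
  have [m hm] := nat_gt (2 / r).
  have m0 : 0 < m.+1%:R^-1 :> R by rewrite invr_gt0.
  have mr : m.+1%:R^-1 * 2 < r.
    rewrite mulrC ltr_pdivrMr // mulrC -ltr_pdivrMr // (lt_trans hm) // ltr_nat //.
  have [i hi] := dense_near (g w) du m0.
  exists i, m; split=> // y hy; apply: hr; rewrite -ball_normE /=.
  apply: le_lt_trans (ler_distD (u i) _ _) _; rewrite [`|u i - y|]distrC.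
  by move: hi hy mr; move: (m.+1%:R^-1) => q; lra.
apply: mset_exists => i; apply: mset_exists => m; apply: mset_and.
  exact: mset_cstP.
by apply: mset_lt => //; exact: measurable_cst.
Qed.

(** Substituting for [h w] a dense [u i] within [1/(m+1)] of it splits a condition on [g w - h w]
    into separate conditions on [g w] and on [h w]. *)
Lemma borel_sub (g h : Om -> X) :
  borel_meas g -> borel_meas h -> borel_meas (fun w => g w - h w).
Proof.
move=> mg mh; apply: borel_of_norm => j; apply: measurable_fun_lt => c.
have -> : [set w | `|g w - h w - u j| < c] = [set w | exists i, exists m : nat,
    `|h w - u i| < m.+1%:R^-1 /\ `|g w - (u i + u j)| + m.+1%:R^-1 < c].
  have eqB a b : a - b - u j = a - (b + u j) by rewrite opprD addrA.
  apply/seteqP; split=> w /=.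
    move=> lt_c; have [m hm] := nat_gt (2 / (c - `|g w - h w - u j|)).
    have c0 : 0 < c - `|g w - h w - u j| by rewrite subr_gt0.
    have m0 : 0 < m.+1%:R^-1 :> R by rewrite invr_gt0.
    have mr : m.+1%:R^-1 * 2 < c - `|g w - h w - u j|.
      by rewrite mulrC ltr_pdivrMr // mulrC -ltr_pdivrMr // (lt_trans hm) // ltr_nat.
    have [i hi] := dense_near (h w) du m0; exists i, m; split=> //.
    have := ler_distD (g w - h w - u j) (g w - (u i + u j)) 0; rewrite !subr0 -eqB.
    have -> : g w - u i - u j - (g w - h w - u j) = h w - u i.
      by rewrite opprB addrA subrK opprB addrC addrA subrK.
    by move: hi mr; move: (m.+1%:R^-1) => q; lra.
  move=> [i [m [hi lt_c]]]; apply: le_lt_trans lt_c.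
  have := ler_distD (g w - (u i + u j)) (g w - h w - u j) 0; rewrite !subr0 -eqB.
  have -> : g w - h w - u j - (g w - u i - u j) = u i - h w.
    by rewrite opprB addrA subrK opprB addrC addrA subrK.
  by rewrite [`|u i - h w|]distrC => /le_trans; apply; rewrite addrC lerD2l ltW.
apply: mset_exists => i; apply: mset_exists => m; apply: mset_and.
  by apply: mset_lt; [exact: borel_norm | exact: measurable_cst].
apply: mset_lt; last exact: measurable_cst.
by apply: measurable_funD; [exact: borel_norm | exact: measurable_cst].
Qed.

Lemma borel_cvg (G : nat -> Om -> X) (F : Om -> X) :
  (forall n, borel_meas (G n)) -> (forall w, G n w @[n --> \oo] --> F w) ->
  borel_meas F.
Proof.
move=> mG GF; apply: borel_of_norm => i.
apply: (measurable_fun_cvg (h := fun n w => `|G n w - u i|)).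
  by move=> n; exact: borel_norm.
by move=> w _; apply: cvg_norm; apply: cvgB; [exact: GF | exact: cvg_cst].
Qed.

Variable L : Om -> X -> X.
Hypothesis mL : strongly_meas L.
Hypothesis linL : forall w, lin (L w).
Hypothesis bL : forall w, bounded_op (L w).

(* [|L_w g_w - v| < c] holds iff some dense [u i] near [g w] and some integer
   bound [N] on [L_w] witness it. *)
Lemma borel_apply (g : Om -> X) : borel_meas g -> borel_meas (fun w => L w (g w)).
Proof.
move=> mg; apply: borel_of_norm => j; apply: measurable_fun_lt => c.
have -> : [set w | `|L w (g w) - u j| < c] = [set w | exists N : nat, exists i,
    (forall i', `|L w (u i') - 0| <= N%:R * `|u i'|) /\
    `|L w (u i) - u j| + N%:R * `|g w - u i| < c].
  apply/seteqP; split=> w /=.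
    move=> lt_c; have [c' hc'] := bL w; have [N hN] := nat_gt `|c'|.
    have hL f : `|L w f| <= N%:R * `|f|.
      apply: le_trans (hc' f) _; rewrite ler_wpM2r // (le_trans (ler_norm _)) // ltW //.
    (* The error [N |g w - u i|] occurs twice: in replacing [g w] by [u i] under [L w], and as the
       explicit summand of the condition. The [+ 1] keeps the denominator positive. *)
    pose e := (c - `|L w (g w) - u j|) / (2 * N%:R + 1).
    have N0 : 0 < 2 * N%:R + 1 :> R by rewrite ltr_wpDl // mulr_ge0.
    have e0 : 0 < e by rewrite divr_gt0 // subr_gt0.
    have [i hi] := dense_near (g w) du e0.
    exists N, i; split; first by move=> i'; rewrite subr0.
    have : `|L w (u i) - u j| <= `|L w (g w) - u j| + N%:R * `|g w - u i|.
      rewrite [leRHS]addrC; apply: le_trans (ler_distD (L w (g w)) _ _) _.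
      by rewrite lerD2r distrC -linB.
    have : (2 * N%:R + 1) * `|g w - u i| < c - `|L w (g w) - u j|.
      by rewrite mulrC -ltr_pdivlMr.
    have := normr_ge0 (g w - u i); move=> *; lra.
  move=> [N [i [hN lt_c]]]; apply: le_lt_trans lt_c.
  have hL : forall f, `|L w f| <= N%:R * `|f|.
    apply: (le_of_dense du).
    - move=> f; apply: cvg_norm; exact: bounded_op_continuous.
    - by move=> f; apply: cvgM; [exact: cvg_cst | apply: cvg_norm].
    - by move=> i'; have := hN i'; rewrite subr0.
  apply: le_trans (ler_distD (L w (u i)) _ _) _.
  by rewrite addrC lerD2l -linB.
apply: mset_exists => N; apply: mset_exists => i; apply: mset_and.
  apply: mset_forall => i'; apply: mset_le; last exact: measurable_cst.
  exact: borel_norm (mL _).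
apply: mset_lt; last exact: measurable_cst.
apply: measurable_funD; first exact: borel_norm (mL _).
by apply: measurable_funM; [exact: measurable_cst | exact: borel_norm].
Qed.

End BorelMeas.

(** * Iterates of an operator cocycle *)

Section Cocycle.
Context {R : realType} {d : measure_display} {Om : measurableType d}.
Context {X : completeNormedModType R}.
Variables (L : Om -> X -> X) (s : Om -> Om).
Hypothesis linL : forall w, lin (L w).
Hypothesis bL : forall w, bounded_op (L w).

Lemma cocycle_lin n w : lin (cocycle L s n w).
Proof. by elim: n => [|n IHn] a f g //=; rewrite IHn linL. Qed.

Lemma cocycle_bounded n w : bounded_op (cocycle L s n w).
Proof.
elim: n => [|n [c hc]]; first by exists 1 => f; rewrite mul1r.
have [c' hc'] := bL (iter n s w); exists (`|c'| * c) => f /=.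
apply: le_trans (hc' _) _; rewrite -mulrA.
apply: le_trans (_ : _ <= `|c'| * `|cocycle L s n w f|) _.
  by rewrite ler_wpM2r // ler_norm.
by rewrite ler_wpM2l.
Qed.

Lemma cocycleD m n w f :
  cocycle L s (m + n) w f = cocycle L s m (iter n s w) (cocycle L s n w f).
Proof. by elim: m => [//|m IHm]; rewrite addSn /= IHm iterD. Qed.

Lemma borel_cocycle (u : nat -> X) n f : dense (range u) -> strongly_meas L ->
  measurable_fun setT s -> borel_meas (fun w => cocycle L s n w f).
Proof.
move=> du mL ms; elim: n => [|n IHn] /=.
  by move=> U oU; exact: mset_cstP.
apply: (borel_apply (L := fun w => L (iter n s w)) du) => //.
by move=> g; apply: borel_comp (mL g) _; exact: measurable_iter.
Qed.

End Cocycle.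

(** * Bounds along backward orbits *)

Section Orbits.
Context {R : realType} {d : measure_display} {Om : measurableType d}.
Variables (s sinv : Om -> Om).
Hypothesis sK : cancel s sinv.
Hypothesis sinvK : cancel sinv s.

Lemma iterK n : cancel (iter n s) (iter n sinv).
Proof. by elim: n => [//|n IHn] w; rewrite [iter _ s w]iterS iterSr sK IHn. Qed.

Lemma iter_s_sinv n m w : iter n s (iter (m + n) sinv w) = iter m sinv w.
Proof.
have itK p : cancel (iter p sinv) (iter p s).
  by elim: p => [//|p IHp] v; rewrite [iter _ sinv v]iterS iterSr sinvK IHp.
by rewrite addnC iterD itK.
Qed.

Variable P : probability Om R.
Hypothesis ms : measurable_fun setT s.
Hypothesis msinv : measurable_fun setT sinv.
Hypothesis Ps : forall A, measurable A -> P (s @^-1` A) = P A.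

Lemma preserving_inv A : measurable A -> P (sinv @^-1` A) = P A.
Proof.
move=> mA; rewrite -Ps; last by rewrite -[X in measurable X]setTI; exact: msinv.
by rewrite -comp_preimage; congr (P _); apply/seteqP; split=> w; rewrite /preimage /= sK.
Qed.

Lemma ergodic_inv : (forall A, measurable A -> s @^-1` A = A -> P A = 0%E \/ P A = 1%E) ->
  forall A, measurable A -> sinv @^-1` A = A -> P A = 0%E \/ P A = 1%E.
Proof.
move=> erg A mA eqA; apply: erg => //; rewrite -[in LHS]eqA.
by apply/seteqP; split=> w; rewrite /preimage /= sK.
Qed.

Definition orbitwise (Q : Om -> Prop) (w : Om) :=
  (forall n, Q (iter n s w)) /\ (forall n, Q (iter n sinv w)).

Lemma ae_orbitwise Q : {ae P, forall w, Q w} -> {ae P, forall w, orbitwise Q w}.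
Proof.
move=> aeQ; have := ae_iter ms Ps aeQ; have := ae_iter msinv preserving_inv aeQ.
by apply: filterS2 => w h h'; split.
Qed.

Lemma orbitwise_id Q w : orbitwise Q w -> Q w. Proof. by case=> /(_ 0%N). Qed.

Lemma orbitwise_sinv Q w n : orbitwise Q w -> orbitwise Q (iter n sinv w).
Proof.
move=> [hs hi]; split=> m; last by rewrite -iterD; exact: hi.
have [mn|/ltnW nm] := leqP m n.
  by rewrite -(subnK mn) iter_s_sinv; exact: hi.
by rewrite -(subnK nm) iterD -[n in iter n sinv](add0n n) iter_s_sinv; exact: hs.
Qed.

End Orbits.

(** * Pullback bounds and the iterated Lasota-Yorke inequality *)

Section Bounds.
Context {R : realType} {d : measure_display} {Om : measurableType d}.
Context {X : completeNormedModType R}.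
Variables (s sinv : Om -> Om).
Hypothesis sK : cancel s sinv.
Hypothesis sinvK : cancel sinv s.
Hypothesis ms : measurable_fun setT s.
Hypothesis msinv : measurable_fun setT sinv.
Variables (u : nat -> X) (Lk : nat -> Om -> X -> X).
Hypothesis du : dense (range u).
Hypothesis mLk : forall k, strongly_meas (Lk k).
Hypothesis linLk : forall k w, lin (Lk k w).
Hypothesis bLk : forall k w, bounded_op (Lk k w).

(* Uniform in [k] and [n]: this is [C(w) <= M] of (H2) for the weak norm. *)
Definition pullback_bound (nrm : X -> R) (w : Om) (M : R) :=
  forall k n f, nrm (cocycle (Lk k) s n (iter n sinv w) f) <= M * nrm f.

Lemma pullback_bound_fwd nrm n w M k f : pullback_bound nrm (iter n s w) M ->
  nrm (cocycle (Lk k) s n w f) <= M * nrm f.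
Proof. by move=> /(_ k n f); rewrite iterK. Qed.

Lemma pullback_bound_le nrm w M M' : (forall f, 0 <= nrm f) -> M <= M' ->
  pullback_bound nrm w M -> pullback_bound nrm w M'.
Proof.
by move=> nrm0 MM' hM k n f; apply: le_trans (hM k n f) _; rewrite ler_wpM2r.
Qed.

(** By continuity it suffices to test the bound on the dense sequence, which leaves countably many
    conditions. *)
Lemma measurable_pullback_bound nrm M : continuous nrm ->
  measurable [set w | pullback_bound nrm w M].
Proof.
move=> cnrm; have -> : [set w | pullback_bound nrm w M] = [set w | forall k n i,
    nrm (cocycle (Lk k) s n (iter n sinv w) (u i)) <= M * nrm (u i)].
  apply/seteqP; split=> w h k n => [i|]; first exact: h.
  apply: (le_of_dense du _ _ (h k n)).
    move=> f; apply: continuous_comp; last exact: cnrm.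
    by apply: bounded_op_continuous; [exact: cocycle_lin | exact: cocycle_bounded].
  by move=> f; apply: cvgM; [exact: cvg_cst | exact: cnrm].
apply: mset_forall => k; apply: mset_forall => n; apply: mset_forall => i.
apply: mset_le; last exact: measurable_cst.
apply: (borel_continuous cnrm).
apply: (borel_comp (g := fun w => cocycle (Lk k) s n w (u i))); last exact: measurable_iter.
exact: (borel_cocycle _ _ _ _ du).
Qed.

Variables (wn : X -> R) (J : R).
Hypothesis wnJ : forall f, wn f <= J * `|f|.
Hypothesis J0 : 0 <= J.
Variables (alpha : Om -> R) (B : R).
Hypothesis alpha0 : forall w, 0 <= alpha w.
Hypothesis B0 : 0 <= B.

Definition lasota_yorke (w : Om) :=
  forall k f, `|Lk k w f| <= alpha w * `|f| + B * wn f.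

(** The induction splits off the last operator, the one at [sinv w]. It multiplies the strong bound
    for the earlier operators by [alpha (sinv w)] and adds [B] times their weak bound, at most
    [c (sinv w) * (J * |f|)]. *)
Lemma lasota_yorke_pullback (c : Om -> R) n w :
  (forall m, lasota_yorke (iter m sinv w)) ->
  (forall m, pullback_bound wn (iter m sinv w) (c (iter m sinv w))) ->
  (forall m, 0 <= c (iter m sinv w)) ->
  forall k f, `|cocycle (Lk k) s n (iter n sinv w) f| <=
    (\prod_(i < n) alpha (iter i.+1 sinv w) +
     B * J * \sum_(j < n) (\prod_(i < j) alpha (iter i.+1 sinv w)) * c (iter j.+1 sinv w))
    * `|f|.
Proof.
elim: n w => [|n IHn] w ly wb c0 k f.
  by rewrite !big_ord0 mulr0 addr0 mul1r.
rewrite [cocycle _ _ _ _ _]/=.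
have -> : iter n s (sinv (iter n sinv w)) = sinv w.
  exact: (iter_s_sinv sinvK n 1).
rewrite -iterS iterSr.
apply: le_trans (ly 1%N k _) _.
have ly' m : lasota_yorke (iter m sinv (sinv w)) by rewrite -iterSr; exact: ly.
have wb' m : pullback_bound wn (iter m sinv (sinv w)) (c (iter m sinv (sinv w))).
  by rewrite -iterSr; exact: wb.
have c0' m : 0 <= c (iter m sinv (sinv w)) by rewrite -iterSr; exact: c0.
have IH := IHn (sinv w) ly' wb' c0' k f.
have wbn : wn (cocycle (Lk k) s n (iter n sinv (sinv w)) f) <= c (sinv w) * (J * `|f|).
  apply: le_trans (wb 1%N k n f) _; rewrite ler_wpM2l //; exact: (c0 1%N).
apply: le_trans (lerD (ler_wpM2l (alpha0 _) IH) (ler_wpM2l B0 wbn)) _.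
rewrite !big_ord_recl /= big_ord0 mul1r.
have -> : \sum_(i < n) (\prod_(i0 < bump 0 i) alpha (sinv (iter i0 sinv w))) *
      c (sinv (iter (bump 0 i) sinv w)) =
   alpha (sinv w) * \sum_(j < n) (\prod_(i < j) alpha (iter i.+1 sinv (sinv w))) *
      c (iter j.+1 sinv (sinv w)).
  rewrite mulr_sumr; apply: eq_bigr => j _; rewrite /bump /= add1n big_ord_recl /= -mulrA.
  congr (_ * (_ * _)); last by rewrite -iterS iterSr.
  by apply: eq_bigr => i _; rewrite /bump /= ?add1n ?add0n -iterSr.
have -> : \prod_(i < n) alpha (sinv (iter (bump 0 i) sinv w)) =
    \prod_(i < n) alpha (iter i.+1 sinv (sinv w)).
  by apply: eq_bigr => i _; rewrite /bump /= ?add1n ?add0n -iterSr.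
rewrite le_eqVlt; apply/orP; left; apply/eqP; ring.
Qed.

(** The decay rate [g] of [a] beats the growth rate [g / 2] of [c]: the terms are dominated by a
    geometric series of ratio [expR (- (g / 2))]. *)
Lemma bounded_pullback_sum (a c : nat -> R) (g K K' : R) : 0 < g ->
  (forall n, 0 <= a n) -> (forall n, 0 <= c n) ->
  (forall n, a n <= K * expR (- (g * n%:R))) ->
  (forall n, c n <= K' * expR (g / 2 * n%:R)) ->
  exists M : R, forall n, a n + B * J * \sum_(j < n) a j * c j <= M.
Proof.
move=> g0 a0 c0 ha hc.
have K0 : 0 <= K by have := le_trans (a0 0%N) (ha 0%N); rewrite mulr0 oppr0 expR0 mulr1.
have K'0 : 0 <= K' by have := le_trans (c0 0%N) (hc 0%N); rewrite mulr0 expR0 mulr1.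
pose q := expR (- (g / 2)).
have q0 : 0 < q by exact: expR_gt0.
have q1 : q < 1 by rewrite -expR0 ltr_expR oppr_lt0 divr_gt0.
have hac j : a j * c j <= K * K' * q ^+ j.
  apply: le_trans (ler_pM (a0 j) (c0 j) (ha j) (hc j)) _.
  rewrite mulrACA -expRD -expRM_natr le_eqVlt; apply/orP; left; apply/eqP.
  by congr (_ * expR _); field.
exists (K + B * J * (K * K' * (1 - q)^-1)) => n; apply: lerD.
  apply: le_trans (ha n) _; rewrite -[leRHS]mulr1 ler_wpM2l // -expR0 ler_expR.
  by rewrite oppr_le0 mulr_ge0 // ltW.
rewrite ler_wpM2l ?mulr_ge0 //.
apply: le_trans (_ : _ <= \sum_(j < n) K * K' * q ^+ j) _.
  by apply: ler_sum => j _; exact: hac.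
rewrite -mulr_sumr ler_wpM2l ?mulr_ge0 //.
rewrite -[leRHS]mul1r ler_pdivlMr ?subr_gt0 // mulrC -opprB mulNr -subrX1 opprB.
by rewrite lerBlDr lerDl exprn_ge0 // ltW.
Qed.

End Bounds.

(** * Perturbation of the decaying cocycle *)

Section Perturbation.
Context {R : realType} {d : measure_display} {Om : measurableType d}.
Variable P : probability Om R.
Context {X : completeNormedModType R}.
Variables (s sinv : Om -> Om).
Hypothesis sK : cancel s sinv.
Hypothesis sinvK : cancel sinv s.
Hypothesis ms : measurable_fun setT s.
Hypothesis msinv : measurable_fun setT sinv.
Hypothesis Ps : forall A, measurable A -> P (s @^-1` A) = P A.
Hypothesis ergs : forall A, measurable A -> s @^-1` A = A -> P A = 0%E \/ P A = 1%E.

Let Psinv := preserving_inv sK msinv Ps.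
Let ergsinv := ergodic_inv sK ergs.

Variables (wn : X -> R) (J : R).
Hypothesis wnD : forall f g, wn (f + g) <= wn f + wn g.
Hypothesis wnZ : forall a f, wn (a *: f) = `|a| * wn f.
Hypothesis wn_eq0 : forall f, wn f = 0 -> f = 0.
Hypothesis wnJ : forall f, wn f <= J * `|f|.

Lemma wn0 : wn 0 = 0.
Proof. by rewrite -(scale0r (0 : X)) wnZ normr0 mul0r. Qed.

Lemma wnN f : wn (- f) = wn f.
Proof. by rewrite -scaleN1r wnZ normrN1 mul1r. Qed.

Lemma wn_ge0 f : 0 <= wn f.
Proof. by have := wnD f (- f); rewrite subrr wn0 wnN; lra. Qed.

Lemma wn_distC f g : wn (f - g) = wn (g - f).
Proof. by rewrite -opprB wnN. Qed.

Lemma wn_distD g f h : wn (f - h) <= wn (f - g) + wn (g - h).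
Proof. by have := wnD (f - g) (g - h); rewrite addrA subrK. Qed.

Lemma wn_continuous : continuous wn.
Proof.
apply: (@continuous_of_lipschitz _ _ _ J) => f g.
by have := wnD g (f - g); rewrite addrC subrK => /le_trans; apply; rewrite lerD2l.
Qed.

Lemma normr_continuous : continuous (fun f : X => `|f|).
Proof. by move=> f; exact: cvg_norm. Qed.

Variables (I : X -> R) (CI : R).
Hypothesis I_lin : forall a f g, I (a *: f + g) = a * I f + I g.
Hypothesis I_wn : forall f, `|I f| <= CI * wn f.
Hypothesis CI0 : 0 <= CI.

Lemma I0 : I 0 = 0.
Proof. by have := I_lin 1 0 0; rewrite scale1r addr0 mul1r; lra. Qed.

Lemma IB f g : I (f - g) = I f - I g.
Proof. by rewrite addrC -scaleN1r I_lin mulN1r addrC. Qed.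

Lemma IZ a f : I (a *: f) = a * I f.
Proof. by rewrite -[a *: f]addr0 I_lin I0 addr0. Qed.

Lemma I_continuous : continuous I.
Proof.
apply: (@continuous_of_lipschitz _ _ _ (CI * J)) => f g.
rewrite -lerBlDl -IB; apply: le_trans (ler_norm _) _; apply: le_trans (I_wn _) _.
by rewrite -mulrA ler_wpM2l.
Qed.

(** [NN] stands for the cone of non-negative functions and [negp] for the [L^1] norm of the negative
    part, so that membership in the cone is the vanishing of a continuous functional. *)
Variables (NN : X -> Prop) (negp : X -> R).
Hypothesis negpP : forall f, NN f <-> negp f = 0.
Hypothesis negp_ge0 : forall f, 0 <= negp f.
Hypothesis negp_lip : forall f g, negp f <= negp g + CI * wn (f - g).

Lemma negp_continuous : continuous negp.
Proof.
apply: (@continuous_of_lipschitz _ _ _ (CI * J)) => f g.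
by apply: le_trans (negp_lip f g) _; rewrite lerD2l -mulrA ler_wpM2l.
Qed.

Variable e : X.
Hypothesis Ie : I e = 1.
Hypothesis NNe : NN e.

(** Compactness of the embedding enters in this form. The net elements have mean zero themselves, so
    each of them decays under [L]. *)
Hypothesis nets : forall eps : R, 0 < eps -> exists fs : seq X,
  (forall g, g \in fs -> I g = 0) /\
  forall f, I f = 0 -> `|f| <= 1 -> exists2 g, g \in fs & wn (f - g) <= eps.

Variable u : nat -> X.
Hypothesis du : dense (range u).

Variables (L : Om -> X -> X) (Lk : nat -> Om -> X -> X).
Hypothesis mL : strongly_meas L.
Hypothesis linL : forall w, lin (L w).
Hypothesis bL : forall w, bounded_op (L w).
Hypothesis mLk : forall k, strongly_meas (Lk k).
Hypothesis linLk : forall k w, lin (Lk k w).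
Hypothesis bLk : forall k w, bounded_op (Lk k w).

Variables (alpha : Om -> R) (B : R).
Hypothesis malpha : measurable_fun setT alpha.
Hypothesis alpha0 : forall w, 0 <= alpha w.
Hypothesis B0 : 0 <= B.

Variable tau : nat -> R.
Hypothesis tau0 : forall k, 0 <= tau k.
Hypothesis tau_cvg : tau @ \oo --> 0.

Local Notation WB := (pullback_bound s sinv Lk wn).
Local Notation SB := (pullback_bound s sinv Lk (fun f : X => `|f|)).

(** The properties of a single fibre that hold almost surely. Bounds are natural numbers, so that
    [pos_cover] can make them uniform on a non-null set. *)
Definition good (w : Om) :=
  [/\ (forall k f, I (Lk k w f) = I f) /\ (forall f, I (L w f) = I f),
      (forall k f, NN f -> NN (Lk k w f)) /\ (forall f, NN f -> NN (L w f)),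
      (forall k f, wn (L w f - Lk k w f) <= tau k * `|f|),
      lasota_yorke Lk wn alpha B w /\
      (forall eps : R, 0 < eps -> exists m, \prod_(i < m) alpha (iter i s w) <= eps) &
      (exists M : nat, WB w M%:R) /\ (exists M : nat, SB w M%:R)].

Definition decaying (w : Om) :=
  forall f, I f = 0 -> wn (cocycle L s n w f) @[n --> \oo] --> 0.

Local Notation Good := (orbitwise s sinv good).

Hypothesis ae_good : {ae P, forall w, Good w}.
Hypothesis ae_decaying : {ae P, forall w, decaying w}.

Let ae_good_decaying : {ae P, forall w, Good w /\ decaying w}.
Proof. by apply: filterS2 ae_good ae_decaying => w. Qed.

Let measurable_WB M : measurable [set w | WB w M].
Proof.
by apply: (measurable_pullback_bound ms msinv du mLk linLk bLk); exact: wn_continuous.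
Qed.

Let measurable_SB M : measurable [set w | SB w M].
Proof.
by apply: (measurable_pullback_bound ms msinv du mLk linLk bLk); exact: normr_continuous.
Qed.

Lemma le_of_tau (a b c : R) : (forall k, a <= b + tau k * c) -> a <= b.
Proof.
move=> h; have cv : b + tau k * c @[k --> \oo] --> b.
  rewrite -[X in _ --> X]addr0 -(mul0r c); apply: cvgD; first exact: cvg_cst.
  by apply: cvgM; [exact: tau_cvg | exact: cvg_cst].
rewrite -(cvg_lim _ cv) //; apply: limr_ge; first by apply/cvg_ex; exists b.
exact: nearW.
Qed.

(** The weak bound for one step of [Lk k] does not depend on [k], and the error [tau k * |f|] of
    (H3) disappears in the limit. *)
Lemma L_weak1 w M f : good w -> WB (s w) M -> wn (L w f) <= M * wn f.
Proof.
move=> [_ _ htau _ _] wb; apply: (@le_of_tau _ _ `|f|) => k.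
have := wnD (Lk k w f) (L w f - Lk k w f); rewrite addrC subrK => /le_trans; apply.
by apply: lerD => //; have := wb k 1%N f; rewrite /= sK.
Qed.

(** The geometric sum [H + H^2 + ... + H^n]. *)
Fixpoint tele (H : R) (n : nat) : R := if n is n'.+1 then H * tele H n' + H else 0.

Lemma tele_ge0 H n : 0 <= H -> 0 <= tele H n.
Proof. by move=> H0; elim: n => //= n IHn; rewrite addr_ge0 // mulr_ge0. Qed.

(** Each step uses [Lk f1 - L f2 = (Lk - L) f1 + L (f1 - f2)]: (H3) bounds the first term through
    the strong norm of [f1], and the weak bound on [L] propagates the second. *)
Lemma telescope H n w : 0 <= H ->
  (forall i, (i <= n)%N -> good (iter i s w) /\ WB (iter i s w) H /\ SB (iter i s w) H) ->
  forall k f, wn (cocycle (Lk k) s n w f - cocycle L s n w f) <= tau k * tele H n * `|f|.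
Proof.
move=> H0; elim: n => [|n IHn] hi k f; first by rewrite /= subrr wn0 mulr0 mul0r.
rewrite /=; set f1 := cocycle (Lk k) s n w f; set f2 := cocycle L s n w f.
have IH : wn (f1 - f2) <= tau k * tele H n * `|f|.
  by apply: IHn => i ilen; apply: hi; exact: leqW.
have [gn [_ sbn]] := hi n (leqnSn n).
have [_ [wbn _]] := hi n.+1 (leqnn _).
apply: le_trans (wn_distD (L (iter n s w) f1) _ _) _.
rewrite -linB // [wn (Lk _ _ _ - _)]wn_distC.
have h1 : wn (L (iter n s w) f1 - Lk k (iter n s w) f1) <= tau k * (H * `|f|).
  have [_ _ htau _ _] := gn; apply: le_trans (htau k f1) _.
  by rewrite ler_wpM2l //; exact: (pullback_bound_fwd sK k f sbn).
have h2 : wn (L (iter n s w) (f1 - f2)) <= H * (tau k * tele H n * `|f|).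
  by apply: le_trans (L_weak1 _ gn wbn) _; rewrite ler_wpM2l.
by apply: le_trans (lerD h1 h2) _; rewrite le_eqVlt; apply/orP; left; apply/eqP; ring.
Qed.

Lemma uniform_bound n w : Good w -> exists H : nat,
  forall i, (i <= n)%N -> WB (iter i s w) H%:R /\ SB (iter i s w) H%:R.
Proof.
move=> [hs _]; elim: n => [|n [H hH]].
  have [_ _ _ _ [[M hM] [M' hM']]] := hs 0%N; exists (maxn M M') => i.
  rewrite leqn0 => /eqP ->; split.
    by apply: pullback_bound_le hM; [exact: wn_ge0 | rewrite ler_nat leq_maxl].
  by apply: pullback_bound_le hM'; [move=> ? | rewrite ler_nat leq_maxr].
have [_ _ _ _ [[M hM] [M' hM']]] := hs n.+1; exists (maxn H (maxn M M')) => i.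
rewrite leq_eqVlt => /orP[/eqP ->|]; last first.
  rewrite ltnS => /hH[h1 h2]; split.
    by apply: pullback_bound_le h1; [exact: wn_ge0 | rewrite ler_nat leq_maxl].
  by apply: pullback_bound_le h2; [move=> ? | rewrite ler_nat leq_maxl].
split.
  by apply: pullback_bound_le hM; [exact: wn_ge0 | rewrite ler_nat !leq_max leqnn orbT].
by apply: pullback_bound_le hM'; [move=> ? | rewrite ler_nat !leq_max leqnn !orbT].
Qed.

Lemma perturbation_bound n w : Good w -> exists h : R, 0 <= h /\
  forall k f, wn (cocycle (Lk k) s n w f - cocycle L s n w f) <= tau k * h * `|f|.
Proof.
move=> gw; have [H hH] := uniform_bound n gw; exists (tele H%:R n); split.
  exact: tele_ge0.
by apply: telescope => // i /hH[h1 h2]; split => //; case: gw.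
Qed.

(** The perturbation constant [h] depends on [n] and [w], yet leaves no trace in the bound, because
    [k] tends to infinity with both fixed. *)
Lemma L_weak n w M f : Good w -> WB (iter n s w) M ->
  wn (cocycle L s n w f) <= M * wn f.
Proof.
move=> gw wb; have [h [_ hh]] := perturbation_bound n gw.
apply: (@le_of_tau _ _ (h * `|f|)) => k.
have := wn_distD (cocycle (Lk k) s n w f) (cocycle L s n w f) 0.
rewrite !subr0 => /le_trans; apply; rewrite addrC; apply: lerD.
  exact: (pullback_bound_fwd sK k f wb).
by rewrite wn_distC mulrA.
Qed.

Lemma cocycle_I (A : Om -> X -> X) n w f :
  (forall i, forall g, I (A (iter i s w) g) = I g) -> I (cocycle A s n w f) = I f.
Proof. by move=> hA; elim: n => [//|n IHn] /=; rewrite hA. Qed.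

Lemma cocycle_NN (A : Om -> X -> X) n w f :
  (forall i, forall g, NN g -> NN (A (iter i s w) g)) -> NN f -> NN (cocycle A s n w f).
Proof. by move=> hA NNf; elim: n => [//|n IHn] /=; apply: hA. Qed.

Definition acim (A : Om -> X -> X) (F : Om -> X) := borel_meas F /\
  {ae P, forall w, [/\ NN (F w), I (F w) = 1 & A (sinv w) (F (sinv w)) = F w]}.

Definition acim_at (A : Om -> X -> X) (F : Om -> X) (w : Om) :=
  [/\ NN (F w), I (F w) = 1 & A (sinv w) (F (sinv w)) = F w].

Lemma ae_acim A F : acim A F -> {ae P, forall w, orbitwise s sinv (acim_at A F) w}.
Proof. by move=> [_ h]; apply: (ae_orbitwise sK ms msinv Ps). Qed.

Lemma acim_fwd A F w n : orbitwise s sinv (acim_at A F) w ->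
  cocycle A s n w (F w) = F (iter n s w).
Proof.
move=> [h _]; elim: n => [//|n IHn] /=; rewrite IHn.
by have [_ _] := h n.+1; rewrite /= sK.
Qed.

Lemma acim_bwd A F w n : orbitwise s sinv (acim_at A F) w ->
  cocycle A s n (iter n sinv w) (F (iter n sinv w)) = F w.
Proof.
move=> h; rewrite acim_fwd; first by rewrite -[n in iter n sinv]add0n iter_s_sinv.
exact: orbitwise_sinv.
Qed.

(** Almost every orbit visits each set where [th] exceeds [1/(m+1)] only finitely often, so these
    sets are null. *)
Lemma ae_le0_of_cvg0 (th : Om -> R) : measurable_fun setT th ->
  {ae P, forall w, forall eps : R, 0 < eps ->
     exists N, forall n, th (iter (N + n) s w) <= eps} ->
  {ae P, forall w, th w <= 0}.
Proof.
move=> mth aeth.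
have : {ae P, forall w, forall m : nat, ~ (m.+1%:R^-1 < th w)}.
  apply: ae_foralln => m; apply/negligibleP.
    by apply: mset_not; apply: mset_not; apply: mset_lt => //; exact: measurable_cst.
  have -> : ~` [set x | ~ (m.+1%:R^-1 < th x)] = [set x | m.+1%:R^-1 < th x].
    by rewrite -[RHS]setCK.
  apply: (null_of_finite_visits ms Ps).
    by apply: mset_lt => //; exact: measurable_cst.
  apply: filterS aeth => w /(_ m.+1%:R^-1) []; first by rewrite invr_gt0.
  by move=> N hN; exists N => n /=; rewrite ltNge hN.
apply: filterS => w h; rewrite leNgt; apply/negP => th0.
have [m hm] := nat_gt (th w)^-1; apply: (h m).
rewrite -[ltRHS]invrK ltf_pV2 ?posrE ?invr_gt0 ?ltr0Sn //.
by apply: lt_trans hm _; rewrite ltr_nat.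
Qed.

Let cvg0_bound (v : nat -> R) (eps : R) : v @ \oo --> 0 -> 0 < eps ->
  exists N, forall n, v (N + n)%N <= eps.
Proof.
move=> /cvgrPdist_le/(_ eps) h e0; have [N _ hN] := h e0; exists N => n.
have := hN (N + n)%N (leq_addr _ _); rewrite sub0r normrN; exact: le_trans (ler_norm _).
Qed.

(** Since [L^(n) e] stays in the cone, [negp] of [F0] at [s^n w] is at most [CI] times the weak norm
    of [L^(n) (F0 w - e)]. This tends to 0, as [F0 w - e] has mean zero, and recurrence applies. *)
Lemma acim_of_equivariant F0 : borel_meas F0 ->
  {ae P, forall w, I (F0 w) = 1 /\ L w (F0 w) = F0 (s w)} -> acim L F0.
Proof.
move=> mF0 aeF0; have aeO := ae_orbitwise sK ms msinv Ps aeF0.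
have aeN : {ae P, forall w, negp (F0 w) <= 0}.
  apply: ae_le0_of_cvg0; first exact: (borel_continuous negp_continuous).
  apply: filterS2 ae_good_decaying aeO => w [gw dec] [oF _] eps eps0.
  have fwd n : cocycle L s n w (F0 w) = F0 (iter n s w).
    by elim: n => [//|n IHn] /=; rewrite IHn; case: (oF n).
  have I0e : I (F0 w - e) = 0 by rewrite IB Ie; case: (oF 0%N) => /= -> _; rewrite subrr.
  have cv : CI * wn (cocycle L s n w (F0 w - e)) @[n --> \oo] --> 0.
    by rewrite -(mulr0 CI); apply: cvgM; [exact: cvg_cst | exact: dec].
  have [N hN] := cvg0_bound cv eps0; exists N => n; apply: le_trans (hN n).
  rewrite -fwd linB; last exact: cocycle_lin.
  apply: le_trans (negp_lip _ (cocycle L s (N + n) w e)) _.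
  suff /negpP -> : NN (cocycle L s (N + n) w e) by rewrite add0r.
  by apply: cocycle_NN => // i g; have [hs _] := gw; case: (hs i) => _ [_ hNN] _ _ _; exact: hNN.
split=> //; apply: filterS2 aeN aeO => w negF [hs hi]; split.
- by apply/negpP/eqP; rewrite eq_le negF negp_ge0.
- by case: (hs 0%N).
- by have [_] := hi 1%N; rewrite /= sinvK.
Qed.

(** The difference has mean zero, so its values along the forward orbit, which are its images under
    [L^(n)], decay; recurrence forces it to vanish. *)
Lemma acim_unique F G : acim L F -> acim L G -> {ae P, forall w, G w = F w}.
Proof.
move=> aF aG; have aeF := ae_acim aF; have aeG := ae_acim aG.
have : {ae P, forall w, wn (G w - F w) <= 0}.
  apply: ae_le0_of_cvg0.
    by apply: (borel_continuous wn_continuous); apply: (borel_sub du); [case: aG | case: aF].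
  apply: filterS3 ae_good_decaying aeF aeG => w [gw dec] oF oG eps eps0.
  have IGF : I (G w - F w) = 0.
    have [_ IF _] := orbitwise_id oF; have [_ IG _] := orbitwise_id oG.
    by rewrite IB IF IG subrr.
  have [N hN] := cvg0_bound (dec _ IGF) eps0; exists N => n.
  by rewrite -(acim_fwd _ oF) -(acim_fwd _ oG) -linB //; exact: cocycle_lin.
apply: filterS => w wGF; apply/eqP; rewrite -subr_eq0; apply/eqP/wn_eq0/eqP.
by rewrite eq_le wGF wn_ge0.
Qed.

(** The coefficient of the weak norm after [m] steps: [B] times the sum over [j < m] of the products
    of [alpha (s^i z)] for [j < i < m]. *)
Fixpoint ly_const (m : nat) (z : Om) : R :=
  if m is m'.+1 then alpha (iter m' s z) * ly_const m' z + B else 0.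

Lemma lasota_yorke_fwd k m z g rho :
  (forall i, (i < m)%N -> lasota_yorke Lk wn alpha B (iter i s z)) ->
  (forall j, (j < m)%N -> wn (cocycle (Lk k) s j z g) <= rho) ->
  `|cocycle (Lk k) s m z g| <=
    \prod_(i < m) alpha (iter i s z) * `|g| + ly_const m z * rho.
Proof.
elim: m => [|m IHm] ly hrho; first by rewrite big_ord0 mul1r mul0r addr0.
rewrite [cocycle _ _ _ _ _]/= big_ord_recr /=.
apply: le_trans (ly m (ltnSn m) k _) _.
have {}IHm := IHm (fun i im => ly i (leqW im)) (fun j jm => hrho j (leqW jm)).
apply: le_trans (lerD (ler_wpM2l (alpha0 _) IHm) (ler_wpM2l B0 (hrho m (ltnSn m)))) _.
by rewrite le_eqVlt; apply/orP; left; apply/eqP; ring.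
Qed.

Lemma eventually_all (Q : nat -> X -> Prop) (fs : seq X) :
  (forall g, g \in fs -> exists N, forall n, Q (N + n)%N g) ->
  exists N, forall n g, g \in fs -> Q (N + n)%N g.
Proof.
elim: fs => [|f fs IHfs] h; first by exists 0%N.
have [|N hN] := IHfs; first by move=> g gfs; apply: h; rewrite inE gfs orbT.
have [N' hN'] := h f (mem_head _ _); exists (N + N')%N => n g; rewrite inE => /orP[/eqP ->|].
  by rewrite [(N + N')%N]addnC -addnA.
by rewrite -addnA; exact: hN.
Qed.

(** After normalisation [f] is within [b] of a net element. That element contributes [a] and the
    remainder at most [M * b], so decay on finitely many vectors becomes uniform. *)
Lemma net_bound (fs : seq X) (a b M : R) n w : Good w ->
  (forall f, I f = 0 -> `|f| <= 1 -> exists2 g, g \in fs & wn (f - g) <= b) ->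
  (forall g, g \in fs -> wn (cocycle L s n w g) <= a) ->
  WB (iter n s w) M -> 0 <= M ->
  forall f, I f = 0 -> wn (cocycle L s n w f) <= (a + M * b) * `|f|.
Proof.
move=> gw net hfs wb M0 f If; have [->|f0] := eqVneq f 0.
  by rewrite lin0; [rewrite wn0 normr0 mulr0 | exact: cocycle_lin].
have nf : 0 < `|f| by rewrite normr_gt0.
have [||g gfs hg] := net (`|f|^-1 *: f).
- by rewrite IZ If mulr0.
- by rewrite normrZ normfV normr_id mulVf ?gt_eqF.
have t1 := le_trans (L_weak (`|f|^-1 *: f - g) gw wb) (ler_wpM2l M0 hg).
have t2 := hfs g gfs.
have := wn_distD (cocycle L s n w g) (cocycle L s n w (`|f|^-1 *: f)) 0.
rewrite !subr0 -linB; last exact: cocycle_lin.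
rewrite linZ; last exact: cocycle_lin.
rewrite wnZ normfV normr_id => t3; rewrite mulrC -ler_pdivrMl //.
by move: t1 t2 t3; lra.
Qed.

Let measurable_ly_const m : measurable_fun setT (ly_const m).
Proof.
elim: m => [|m IHm]; first exact: measurable_cst.
apply: measurable_funD; last exact: measurable_cst.
by apply: measurable_funM => //; apply: measurableT_comp => //; exact: measurable_iter.
Qed.

Let measurable_prod m : measurable_fun setT (fun z => \prod_(i < m) alpha (iter i s z)).
Proof.
elim: m => [|m IHm].
  by under eq_fun do rewrite big_ord0; exact: measurable_cst.
under eq_fun do rewrite big_ord_recr /=.
by apply: measurable_funM => //; apply: measurableT_comp => //; exact: measurable_iter.
Qed.

(** With the factor [1/(2M)], a subsequent excursion of strong norm at most [M] still leaves 1/2.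
    Only [Good] fibres are concerned, because [A] is built from measurable conditions without
    removing a null set. *)
Definition contracting (M : R) (N K : nat) (A : set Om) :=
  forall w, A w -> Good w -> SB w M /\
    forall k f, (K <= k)%N -> I f = 0 ->
      `|cocycle (Lk k) s N w f| <= (2 * M)^-1 * `|f|.

(** The first [n] steps make the weak norm small, by decay of [L] on a net and perturbation to [Lk];
    then [m] Lasota-Yorke steps turn weak smallness into strong smallness. Each random constant is
    frozen in turn by [pos_cover], so that later ones may depend on earlier ones. *)
Lemma contraction_set : exists (M : R) (N K : nat) (A : set Om),
  [/\ 0 < M, measurable A, P A <> 0%E & contracting M N K A].
Proof.
have PT0 : P [set: Om] <> 0%E by rewrite probability_setT => /eqP; rewrite onee_eq0.
have [||M0] := pos_cover (Q := fun M w => SB w M.+1%:R) measurableT PT0.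
- by move=> M; exact: measurable_SB.
- apply: filterS ae_good => w gw _; have [_ _ _ _ [_ [M hM]]] := orbitwise_id gw.
  by exists M; apply: pullback_bound_le hM; [move=> ? | rewrite ler_nat].
rewrite setTI; set M : R := M0.+1%:R => PS1; have M_gt0 : 0 < M by rewrite ltr0Sn.
set S1 := [set w | _] in PS1; have mS1 : measurable S1 by exact: measurable_SB.
(* A unit vector arrives at [z] with strong norm at most [M]; this [m] reduces its strong term to
   [1/(4M)], half the target. *)
have [||m] := pos_cover (Q := fun m z =>
  \prod_(i < m) alpha (iter i s z) * M <= (4 * M)^-1) mS1 PS1.
- by move=> m; apply: mset_le; [apply: measurable_funM => //|]; exact: measurable_cst.
- apply: filterS ae_good => w gw _; have [_ _ _ [_ hp] _] := orbitwise_id gw.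
  have [|m hm] := hp ((4 * M)^-1 / M); first by rewrite divr_gt0 // invr_gt0 mulr_gt0.
  by exists m; rewrite -ler_pdivlMr.
set S2 := _ `&` _ => PS2.
have mS2 : measurable S2.
  apply: measurableI => //.
  by apply: mset_le; [apply: measurable_funM => //|]; exact: measurable_cst.
pose Q3 (M2 : nat) z := (forall j, (j <= m)%N -> WB (iter j s z) M2%:R) /\
  ly_const m z <= M2%:R.
have mQ3 M2 : measurable [set z | Q3 M2 z].
  apply: mset_and.
    apply: mset_forall => j; apply: mset_imply.
    exact: (measurable_preiter ms j (Q := fun w => WB w M2%:R)).
  by apply: mset_le => //; exact: measurable_cst.
have [|M2] := pos_cover mS2 PS2 mQ3.
  apply: filterS ae_good => z gz _; have [H hH] := uniform_bound m gz.
  have [N hN] := nat_gt (ly_const m z); exists (maxn H N); split.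
    move=> j jm; have [hj _] := hH j jm.
    by apply: pullback_bound_le hj; [exact: wn_ge0 | rewrite ler_nat leq_maxl].
  by apply: le_trans (ltW hN) _; rewrite ler_nat leq_maxr.
set S3 := _ `&` _ => PS3; have mS3 : measurable S3 by exact: measurableI.
(* Chosen so that the weak term [M2 * (M2 * (3 * del))] is at most [1/(4M)], the other half of the
   target. The mesh [del / (M2 + 1)] keeps the net error below [del]. *)
pose del : R := (12 * M * (M2%:R * M2%:R + 1))^-1.
have del0 : 0 < del.
  by rewrite invr_gt0 mulr_gt0 ?mulr_gt0 // ltr_wpDl // mulr_ge0.
have [fs [Ifs net_fs]] : exists fs : seq X, (forall g, g \in fs -> I g = 0) /\
    forall f, I f = 0 -> `|f| <= 1 -> exists2 g, g \in fs & wn (f - g) <= del / (M2%:R + 1).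
  by apply: nets; rewrite divr_gt0 // ltr_wpDl.
(* All indices are allowed: beyond the list the default vector 0 satisfies the bound, and the
   condition is a countable intersection. *)
pose Q4 n w := S3 (iter n s w) /\ forall i, wn (cocycle L s n w (nth 0 fs i)) <= del.
have mQ4 n : measurable [set w | Q4 n w].
  apply: mset_and; first exact: (measurable_preiter ms n (Q := S3)).
  apply: mset_forall => i; apply: mset_le; last exact: measurable_cst.
  by apply: (borel_continuous wn_continuous); exact: (borel_cocycle linL bL _ _ du).
(* Recurrence supplies a visit to [S3] after all net elements have fallen below [del]. *)
have [|n] := pos_cover mS1 PS1 mQ4.
  apply: filterS2 ae_good_decaying (infinite_visits ms Ps ergs mS3 PS3) => w [gw dec] vis _.
  have [|N hN] := @eventually_all (fun n g => wn (cocycle L s n w g) <= del) fs.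
    by move=> g /Ifs Ig; exact: cvg0_bound (dec g Ig) del0.
  have [n hn] := vis N; exists (N + n)%N; split=> // i.
  have [ifs|ifs] := ltnP i (size fs); first by apply: hN; exact: mem_nth.
  rewrite nth_default // lin0; last exact: cocycle_lin.
  by rewrite wn0 ltW.
set S4 := _ `&` _ => PS4; have mS4 : measurable S4 by exact: measurableI.
pose Q5 (H : nat) w := forall i, (i <= n)%N -> WB (iter i s w) H%:R /\ SB (iter i s w) H%:R.
have mQ5 H : measurable [set w | Q5 H w].
  apply: mset_forall => i; apply: mset_imply; apply: mset_and.
    exact: (measurable_preiter ms i (Q := fun w => WB w H%:R)).
  exact: (measurable_preiter ms i (Q := fun w => SB w H%:R)).
have [|H] := pos_cover mS4 PS4 mQ5.
  by apply: filterS ae_good => w gw _; exact: uniform_bound.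
set A := _ `&` _ => PA.
have [K hK] : exists K, forall k, tau (K + k)%N * tele H%:R n <= del.
  apply: (cvg0_bound (v := fun k => tau k * tele H%:R n)) del0.
  by rewrite -(mul0r (tele H%:R n)); apply: cvgM; [exact: tau_cvg | exact: cvg_cst].
exists M, (m + n)%N, K, A; split=> //; first exact: measurableI.
move=> w [[S1w [[[SBz hprod] [hWB hly]] hfs]] hH] gw; split=> // k f Kk If.
set z := iter n s w in SBz hprod hWB hly.
have unit_case f' : I f' = 0 -> `|f'| <= 1 ->
    `|cocycle (Lk k) s (m + n) w f'| <= (2 * M)^-1.
  move=> If' f'1; rewrite cocycleD -/z; set g := cocycle (Lk k) s n w f'.
  have g_le : `|g| <= M.
    apply: le_trans (pullback_bound_fwd sK k f' SBz) _.
    by rewrite -[leRHS]mulr1 ler_wpM2l // ltW.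
  have wnz := hWB 0%N (leq0n _).
  have wng : wn g <= 3 * del.
    have t1 : wn (g - cocycle L s n w f') <= del.
      have := @telescope H%:R n w (ler0n _ _) _ k f'.
      move=> /(_ (fun i im => conj (gw.1 i) (hH i im))) /le_trans; apply.
      apply: le_trans (_ : _ <= tau k * tele H%:R n * 1) _.
        by rewrite ler_wpM2l // mulr_ge0 // tele_ge0.
      by rewrite mulr1 -(subnKC Kk).
    have t2 : wn (cocycle L s n w f') <= 2 * del.
      have hfs' h : h \in fs -> wn (cocycle L s n w h) <= del.
        by move=> hin; rewrite -(nth_index 0 hin).
      apply: le_trans (net_bound gw net_fs hfs' wnz (ler0n _ _) If') _.
      apply: le_trans (_ : _ <= (del + M2%:R * (del / (M2%:R + 1))) * 1) _.
        by rewrite ler_wpM2l // addr_ge0 ?mulr_ge0 ?divr_ge0 ?addr_ge0 // ltW.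
      have -> : 2 * del = del + del by ring.
      rewrite mulr1 lerD2l mulrCA -[leRHS]mulr1 ler_wpM2l ?ltW //.
      by rewrite ltr_pdivrMr ?ltr_wpDl // mul1r ltrDl.
    have := wn_distD (cocycle L s n w f') g 0.
    by rewrite !subr0; move: t1 t2; lra.
  have := @lasota_yorke_fwd k m z g (M2%:R * (3 * del)).
  move=> /(_ _ _)/le_trans; apply.
  - move=> i _; have [_ _ _ [ly _] _] := gw.1 (i + n)%N.
    by rewrite /z -iterD.
  - move=> j jm; have wbj := hWB j (ltnW jm).
    by apply: le_trans (pullback_bound_fwd sK k g wbj) _; rewrite ler_wpM2l.
  apply: le_trans (_ : _ <= (4 * M)^-1 + M2%:R * (M2%:R * (3 * del))) _.
    apply: lerD; last by rewrite ler_wpM2r // mulr_ge0 // mulr_ge0 // ltW.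
    apply: le_trans hprod; rewrite ler_wpM2l //; exact: prodr_ge0.
  have -> : (2 * M)^-1 = (4 * M)^-1 + (4 * M)^-1 by field; rewrite gt_eqF.
  rewrite lerD2l; set q : R := M2%:R.
  have q0 : 0 <= q by rewrite ler0n.
  have -> : q * (q * (3 * del)) = (4 * M)^-1 * (q * q / (q * q + 1)).
    rewrite /del -/q; field; apply/andP; split; last by rewrite gt_eqF.
    by rewrite gt_eqF // ltr_wpDl // mulr_ge0.
  rewrite -[leRHS]mulr1 ler_wpM2l ?invr_ge0 ?mulr_ge0 ?ltW //.
  by rewrite ltr_pdivrMr ?mul1r ?ltrDl // ltr_wpDl // mulr_ge0.
have [->|f0] := eqVneq f 0.
  rewrite lin0; last exact: cocycle_lin.
  by rewrite normr0 mulr0.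
have nf : 0 < `|f| by rewrite normr_gt0.
have := unit_case (`|f|^-1 *: f); rewrite IZ If mulr0 normrZ normfV normr_id mulVf ?gt_eqF //.
move=> /(_ erefl (lexx _)); rewrite linZ; last exact: cocycle_lin.
by rewrite normrZ normfV normr_id ler_pdivrMl // mulrC.
Qed.

Let geo_small (c eps : R) : 0 < eps -> exists i : nat, c * 2 ^- i < eps.
Proof.
move=> eps0; have [i hi] := nat_gt (c / eps); exists i.
rewrite ltr_pdivrMr ?exprn_gt0 // mulrC -ltr_pdivrMr //; apply: lt_trans hi _.
by rewrite -natrX ltr_nat ltn_expl.
Qed.

(** * The random acim of one perturbed cocycle *)

Section ContractingSet.
Variables (M : R) (N K : nat) (A : set Om).
Hypothesis M_gt0 : 0 < M.
Hypothesis mA : measurable A.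
Hypothesis PA : P A <> 0%E.
Hypothesis hA : contracting M N K A.
Variable k : nat.
Hypothesis Kk : (K <= k)%N.

Let Good_I w n f : Good w -> I (cocycle (Lk k) s n w f) = I f.
Proof. by move=> gw; apply: cocycle_I => i g; have [[h _] _ _ _ _] := gw.1 i; exact: h. Qed.

(* Each visit to the contracting set gains a factor 1/2: the strong bound [M]
   at the visit pays for the excursion since the previous one. *)
Lemma pullback_contraction (A' : set Om) w D : A' `<=` A -> Good w -> 0 <= D -> SB w D ->
  (forall p, exists n, A' (iter (p + n) sinv w)) ->
  forall i, exists n, A' (iter n sinv w) /\
    forall f, I f = 0 -> `|cocycle (Lk k) s n (iter n sinv w) f| <= D * 2 ^- i * `|f|.
Proof.
move=> A'A gw D0 sb vis; elim=> [|i [n [An IHn]]].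
  have [n hn] := vis 0%N; exists n; split=> // f _.
  by rewrite expr0 invr1 mulr1; exact: sb.
(* The new visit lies at least [N] steps further back: its [N] contracting steps gain [1/(2M)], and
   the remaining [p] steps end at the visit already found, where the strong bound [M] holds. *)
have [p hp] := vis (n + N)%N; exists (n + N + p)%N; split=> // f If.
set v := iter (n + N + p) sinv w in hp *.
have gv : Good v by exact: orbitwise_sinv.
have -> : (n + N + p = n + (p + N))%N by rewrite -addnA (addnC N).
rewrite cocycleD.
have -> : iter (p + N) s v = iter n sinv w.
  by rewrite /v -addnA (addnC N) iter_s_sinv.
have I1 : I (cocycle (Lk k) s (p + N) v f) = 0 by rewrite Good_I.
apply: le_trans (IHn _ I1) _.
have [sbn _] := hA (A'A _ An) (orbitwise_sinv sinvK n gw).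
have [_ /(_ k f Kk If) cv] := hA (A'A _ hp) gv.
have h : `|cocycle (Lk k) s (p + N) v f| <= M * ((2 * M)^-1 * `|f|).
  rewrite cocycleD.
  have -> : iter N s v = iter p sinv (iter n sinv w).
    by rewrite /v -iterD [(n + N)%N]addnC -addnA addnC iter_s_sinv // addnC.
  apply: le_trans (sbn k p _) _; rewrite ler_wpM2l // ltW //.
apply: le_trans (ler_wpM2l _ h) _; first by rewrite mulr_ge0 // invr_ge0 exprn_ge0.
rewrite le_eqVlt; apply/orP; left; apply/eqP; rewrite exprS invfM; field.
by rewrite expf_neq0 //= gt_eqF.
Qed.

Let pull n w := cocycle (Lk k) s n (iter n sinv w) e.

Let pullD n q w : pull (n + q) w = cocycle (Lk k) s n (iter n sinv w) (pull q (iter n sinv w)).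
Proof.
by rewrite /pull cocycleD iter_s_sinv // [in LHS]addnC iterD.
Qed.

(** For a visit at time [n] and [p >= n], [pull n - pull p] is the image under [Lk^(n)] of
    [e - pull (p - n)], taken in the fibre of the visit. This vector has mean zero and strong norm
    at most [(1 + M) |e|], so [pullback_contraction] makes the sequence Cauchy. *)
Lemma pull_cvg w : Good w -> (forall p, exists n, A (iter (p + n) sinv w)) ->
  cvgn (pull^~ w).
Proof.
move=> gw vis; have [_ _ _ _ [_ [D sb]]] := orbitwise_id gw.
apply/cauchy_cvgP; apply: cauchy_exP => eps eps0.
have [i hi] := geo_small (D%:R * ((1 + M) * `|e|)) eps0.
have [n [An hn]] := pullback_contraction (fun _ h => h) gw (ler0n _ D) sb vis i.
exists (pull n w); exists n => // p /= np; rewrite -ball_normE /=.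
apply: le_lt_trans hi.
have gn := orbitwise_sinv sinvK n gw.
have -> : pull n w - pull p w =
    cocycle (Lk k) s n (iter n sinv w) (e - pull (p - n) (iter n sinv w)).
  by rewrite -{1}(subnKC np) pullD linB //; exact: cocycle_lin.
apply: le_trans (hn _ _) _.
  rewrite IB Ie /pull Good_I ?Ie ?subrr //; exact: orbitwise_sinv.
rewrite [leRHS]mulrAC ler_wpM2l ?mulr_ge0 ?invr_ge0 ?exprn_ge0 //.
apply: le_trans (ler_normB _ _) _; rewrite mulrDl mul1r lerD2l.
have [sbn _] := hA An gn; exact: sbn.
Qed.

(** The limit of [pull] inherits positivity and integral through continuous functionals. The strong
    bound in the conclusion is uniform in [k] and feeds [acim_convergence]. *)
Lemma acim_k_exists : exists F, acim (Lk k) F /\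
  {ae P, forall w, forall D, SB w D -> `|F w| <= D * `|e|}.
Proof.
have aeG : {ae P, forall w, Good w /\ cvgn (pull^~ w)}.
  have := infinite_visits msinv Psinv ergsinv mA PA.
  by apply: filterS2 ae_good => w gw vis; split=> //; exact: pull_cvg.
have [Nn [mNn PNn hNn]] := aeG.
have okP w : ~ Nn w -> Good w /\ cvgn (pull^~ w) by move=> nN; apply: contrapT => h; exact/nN/hNn.
(* The value 0 on a measurable null set containing all exceptional fibres makes [F] an everywhere
   limit of Borel maps. *)
pose F w := if `[< (~` Nn) w >] then limn (pull^~ w) else 0.
have mF : borel_meas F.
  apply: (borel_cvg du (G := fun n w => if `[< (~` Nn) w >] then pull n w else 0)).
    move=> n; apply: borel_if; first exact: measurableC.
      apply: (borel_comp (g := fun w => cocycle (Lk k) s n w e)); last exact: measurable_iter.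
      exact: (borel_cocycle _ _ _ _ du).
    by move=> U oU; exact: mset_cstP.
  move=> w; rewrite /F; case: asboolP => [nN|_]; last exact: cvg_cst.
  by have [_] := okP w nN.
have ok : {ae P, forall w, ~ Nn w}.
  by exists Nn; split=> // w /= /contrapT.
have F_cvg w : ~ Nn w -> pull n w @[n --> \oo] --> F w.
  by move=> nN; rewrite /F; case: asboolP => // _; have [_] := okP w nN.
have limcst (v : R) (g : X -> R) w : continuous g -> ~ Nn w ->
    (forall n, g (pull n w) = v) -> g (F w) = v.
  move=> cg nN gv; have cv : g (pull n w) @[n --> \oo] --> g (F w).
    by apply: continuous_cvg; [exact: cg | exact: F_cvg].
  rewrite -(cvg_lim _ cv) //; under eq_fun do rewrite gv.
  exact: lim_cst.
exists F; split; first split=> //.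
  apply: filterS (ae_iter msinv Psinv ok) => w okw.
  have nN : ~ Nn w := okw 0%N; have nN1 : ~ Nn (sinv w) := okw 1%N.
  have [gw _] := okP w nN; split.
  - apply/negpP; apply: limcst => //; first exact: negp_continuous.
    move=> n; apply/negpP; apply: cocycle_NN => // i g.
    have [hs _] := orbitwise_sinv sinvK n gw.
    by have [_ [h _] _ _ _] := hs i; exact: h.
  - apply: limcst => //; first exact: I_continuous.
    by move=> n; rewrite /pull Good_I //; exact: orbitwise_sinv.
  (* The fixed-point equation is the limit of [pull n.+1 w = Lk k (sinv w) (pull n (sinv w))]. *)
  - have cv1 : pull n.+1 w @[n --> \oo] --> F w.
      by have := F_cvg w nN; rewrite -cvg_shiftS.
    have cv2 : Lk k (sinv w) (pull n (sinv w)) @[n --> \oo] --> Lk k (sinv w) (F (sinv w)).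
      apply: continuous_cvg; first exact: bounded_op_continuous.
      exact: F_cvg.
    rewrite -(cvg_lim _ cv1) // -(cvg_lim _ cv2) //; congr (limn _).
    by apply/funext => n; rewrite -(addn1 n) addnC pullD.
apply: filterS ok => w nN D sb.
have cv : `|pull n w| @[n --> \oo] --> `|F w| by apply: cvg_norm; exact: F_cvg.
rewrite -(cvg_lim _ cv) //; apply: limr_le; first by apply/cvg_ex; eexists; exact: cv.
by apply: nearW => n; exact: sb.
Qed.

(** On a non-null part [A'] of [A] the difference is bounded by some [m]. Carried to [w] from the
    backward visits to [A'], it is at most [D * 2^-i * m] for every [i]. *)
Lemma acim_k_unique F G : acim (Lk k) F -> acim (Lk k) G -> {ae P, forall w, G w = F w}.
Proof.
move=> aF aG; have mGF : measurable_fun setT (fun w => `|G w - F w|).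
  by apply: (borel_continuous normr_continuous); apply: (borel_sub du); [case: aG | case: aF].
have mQ (m : nat) : measurable [set w | `|G w - F w| <= m%:R].
  by apply: mset_le => //; exact: measurable_cst.
have [|m] := pos_cover mA PA mQ.
  by apply: aeW => w _; have [m hm] := nat_gt `|G w - F w|; exists m; exact: ltW.
set A' := _ `&` _ => PA'; have mA' : measurable A' by exact: measurableI.
have vis := infinite_visits msinv Psinv ergsinv mA' PA'.
have aeF := ae_acim aF; have aeG := ae_acim aG.
have : {ae P, forall w, (orbitwise s sinv (acim_at (Lk k) F) w /\
    orbitwise s sinv (acim_at (Lk k) G) w)} by apply: filterS2 aeF aeG => w.
apply: filterS3 ae_good vis => w gw visw [oF oG].
have [_ _ _ _ [_ [D sb]]] := orbitwise_id gw.
apply/eqP; rewrite -subr_eq0 -normr_le0 leNgt; apply/negP => GF0.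
have [i] := geo_small (D%:R * m%:R) GF0; apply/negP; rewrite -leNgt.
have [n [[_ An] hn]] :=
  pullback_contraction (@subIsetl _ _ _) gw (ler0n _ D) sb visw i.
rewrite -[G w](acim_bwd n oG) -[F w](acim_bwd n oF) -linB; last exact: cocycle_lin.
apply: le_trans (hn _ _) _.
  have [_ IF _] := oF.2 n; have [_ IG _] := oG.2 n.
  by rewrite IB IF IG subrr.
by rewrite mulrAC ler_wpM2r ?invr_ge0 ?exprn_ge0 // ler_wpM2l.
Qed.

End ContractingSet.

(** At [s^n w] the difference is [L^(n) (F w - Fk w)] plus [(L^(n) - Lk^(n)) (Fk w)]. Where the weak
    bound is [M], the first term is small for large [n], uniformly in [k]; the second is small for
    fixed [n] and large [k]. Hence orbits meet [bad m M] finitely often. *)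
Lemma acim_convergence (K : nat) F (Fk : nat -> Om -> X) : acim L F ->
  (forall k, acim (Lk (K + k)) (Fk k)) ->
  (forall k, {ae P, forall w, forall D, SB w D -> `|Fk k w| <= D * `|e|}) ->
  {ae P, forall w, wn (F w - Fk k w) @[k --> \oo] --> 0}.
Proof.
move=> aF aFk bFk.
pose bad (m M : nat) := [set w | WB w M%:R /\
  forall p, exists k, m.+1%:R^-1 < wn (F w - Fk (p + k)%N w)].
have mbad m M : measurable (bad m M).
  apply: mset_and; first exact: measurable_WB.
  apply: mset_forall => p; apply: mset_exists => k.
  apply: mset_lt; first exact: measurable_cst.
  apply: (borel_continuous wn_continuous); apply: (borel_sub du); first by case: aF.
  by case: (aFk (p + k)%N).
have aeFk : {ae P, forall w, forall k, orbitwise s sinv (acim_at (Lk (K + k)) (Fk k)) w /\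
    forall D, SB w D -> `|Fk k w| <= D * `|e|}.
  by apply: ae_foralln => k; apply: filterS2 (ae_acim (aFk k)) (bFk k) => w.
have Pbad m M : P (bad m M) = 0%E.
  apply: (null_of_finite_visits ms Ps) => //.
  apply: filterS3 ae_good_decaying (ae_acim aF) aeFk => w [gw dec] oF oFk.
  have [_ _ _ _ [_ [D sb]]] := orbitwise_id gw.
  (* A strong bound, uniform in [k], for both [Fk k w] and [F w - Fk k w]; the [+ 1] allows division
     by it. *)
  pose Q := `|F w| + D%:R * `|e| + 1.
  have Q0 : 0 < Q by rewrite ltr_wpDl // addr_ge0 // mulr_ge0.
  pose eps : R := m.+1%:R^-1; have eps0 : 0 < eps by rewrite invr_gt0 ltr0Sn.
  have [fs [Ifs net_fs]] : exists fs : seq X, (forall g, g \in fs -> I g = 0) /\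
      forall f, I f = 0 -> `|f| <= 1 ->
        exists2 g, g \in fs & wn (f - g) <= eps / (4 * Q * (M%:R + 1)).
    by apply: nets; rewrite divr_gt0 // mulr_gt0 ?mulr_gt0 // ltr_wpDl.
  have [|N hN] := @eventually_all (fun n g => wn (cocycle L s n w g) <= eps / (4 * Q)) fs.
    move=> g /Ifs Ig; apply: cvg0_bound (dec g Ig) _.
    by rewrite divr_gt0 // mulr_gt0.
  (* [N] does not depend on [k]; the threshold [p] for [k] is chosen afterwards and may depend on
     [N + n]. *)
  exists N => n [wb hbad].
  have [h [h0 hh]] := perturbation_bound (N + n) gw.
  have [p hp] : exists p, forall k, tau (p + k)%N * (h * Q) <= eps / 2.
    apply: (cvg0_bound (v := fun k => tau k * (h * Q))); last by rewrite divr_gt0.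
    by rewrite -(mul0r (h * Q)); apply: cvgM; [exact: tau_cvg | exact: cvg_cst].
  have [k] := hbad p; apply/negP; rewrite -leNgt -/eps.
  have [oFk' bk] := oFk (p + k)%N; have {}bk := bk _ sb.
  have nFk : `|Fk (p + k)%N w| <= Q.
    by apply: le_trans bk _; rewrite /Q -addrA addrCA lerDl addr_ge0.
  have nD : `|F w - Fk (p + k)%N w| <= Q.
    apply: le_trans (ler_normB _ _) _; rewrite /Q -addrA lerD2l.
    by apply: le_trans bk _; rewrite lerDl.
  have ID0 : I (F w - Fk (p + k)%N w) = 0.
    have [_ IF _] := orbitwise_id oF; have [_ IFk _] := orbitwise_id oFk'.
    by rewrite IB IF IFk subrr.
  rewrite -(acim_fwd (N + n) oF) -(acim_fwd (N + n) oFk').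
  apply: le_trans (wn_distD (cocycle L s (N + n) w (Fk (p + k)%N w)) _ _) _.
  rewrite -linB; last exact: cocycle_lin.
  have t1 := net_bound gw net_fs (hN n) wb (ler0n _ M) ID0.
  have t2 := hh (K + (p + k))%N (Fk (p + k)%N w).
  have {}t1 : wn (cocycle L s (N + n) w (F w - Fk (p + k)%N w)) <= eps / 2.
    apply: le_trans t1 _.
    apply: le_trans (_ : _ <= (eps / (4 * Q) + eps / (4 * Q)) * Q) _; last first.
      by rewrite le_eqVlt; apply/orP; left; apply/eqP; field; rewrite gt_eqF.
    apply: ler_pM => //.
      rewrite addr_ge0 ?mulr_ge0 ?invr_ge0 ?mulr_ge0 ?addr_ge0 // ltW //.
    rewrite lerD2l.
    have -> : M%:R * (eps / (4 * Q * (M%:R + 1))) = eps / (4 * Q) * (M%:R / (M%:R + 1)).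
      field; rewrite gt_eqF //= gt_eqF // ltr_wpDl //.
    rewrite -[leRHS]mulr1 ler_wpM2l ?divr_ge0 ?mulr_ge0 ?ltW //.
    by rewrite ltr_pdivrMr ?ltr_wpDl // mul1r ltrDl.
  have {}t2 : wn (cocycle L s (N + n) w (Fk (p + k)%N w) -
      cocycle (Lk (K + (p + k))%N) s (N + n) w (Fk (p + k)%N w)) <= eps / 2.
    rewrite wn_distC; apply: le_trans t2 _; rewrite -mulrA addnCA.
    apply: le_trans (hp (K + k)%N); rewrite ler_wpM2l // ler_wpM2l //.
  by move: t1 t2; lra.
have : {ae P, forall w, forall m M : nat, ~ bad m M w}.
  apply: ae_foralln => m; apply: ae_foralln => M; apply/negligibleP.
    by apply: measurableC; apply: measurableC; exact: mbad.
  have -> : ~` [set x | ~ bad m M x] = bad m M by rewrite -[RHS]setCK.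
  exact: Pbad.
apply: filterS2 ae_good => w gw nbad; have [_ _ _ _ [[M wb] _]] := orbitwise_id gw.
apply/cvgrPdist_le => eps eps0; have [m hm] := nat_gt eps^-1.
have [p hp] : exists p, forall k, wn (F w - Fk (p + k)%N w) <= m.+1%:R^-1.
  apply: contrapT => /forallNP h; apply: (nbad m M); split=> // p.
  by have /existsNP[k /negP] := h p; rewrite -ltNge; exists k.
exists p => // k /= pk; rewrite sub0r normrN ger0_norm ?wn_ge0 //.
rewrite -(subnKC pk); apply: le_trans (hp _) _.
rewrite -[leRHS]invrK lef_pV2 ?posrE ?invr_gt0 ?ltr0Sn //.
by apply: le_trans (ltW hm) _; rewrite ler_nat.
Qed.

End Perturbation.

(** * Decay from the Oseledets splitting *)

Section Rates.
Context {R : realType}.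

Lemma rate_lt (v c : R) (u : nat -> \bar R) n : (0 < n)%N -> u n = v%:E ->
  (rate u n < c%:E)%E -> v <= expR (c * n%:R).
Proof.
move=> n0 uv; rewrite /rate uv /=; have n0' : 0 < n%:R :> R by rewrite ltr0n.
case: ifPn => [v0|]; last by rewrite -leNgt => /le_trans -> //; exact: expR_ge0.
rewrite -EFinM lte_fin ltr_pdivrMr // => h.
by rewrite -(lnK (x := v)) ?posrE // ler_expR ltW.
Qed.

Lemma rate_gt (v c : R) (u : nat -> \bar R) n : (0 < n)%N -> u n = v%:E ->
  (c%:E < rate u n)%E -> expR (c * n%:R) <= v.
Proof.
move=> n0 uv; rewrite /rate uv /=; have n0' : 0 < n%:R :> R by rewrite ltr0n.
case: ifPn => [v0|_]; last by rewrite gt0_mulNye ?lte_fin ?invr_gt0.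
rewrite -EFinM lte_fin ltr_pdivlMr // => h.
by rewrite -(lnK (x := v)) ?posrE // ler_expR ltW.
Qed.

(** Some [-c] lies strictly between the upper limit and 0, so [v n] is eventually at most
    [expR (- c * n)]. *)
Lemma cvg0_of_rate (v : nat -> R) : (forall n, 0 <= v n) ->
  (limn_esup (rate (fun n => (v n)%:E)) < 0)%E -> v @ \oo --> 0.
Proof.
move=> v0 lt0; set u := rate _ in lt0.
have [c c0 ltc] : exists2 c : R, 0 < c & (limn_esup u < (- c)%:E)%E.
  move: lt0; case: (limn_esup u) => [r||] //= h.
    exists (- r / 2); first by rewrite divr_gt0 // oppr_gt0 -lte_fin.
    by rewrite lte_fin; move: h; rewrite lte_fin; lra.
  by exists 1 => //; rewrite ltNyr.
have [n0 hn0] : exists n0, (esups u n0 < (- c)%:E)%E.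
  apply: contrapT => /forallNP h; move: ltc; apply/negP; rewrite -leNgt limn_esup_lim.
  apply: lime_ge; first exact: is_cvg_esups.
  by apply: nearW => n; rewrite leNgt; apply/negP/h.
have le_exp n : (n0 <= n)%N -> (0 < n)%N -> v n <= expR (- c * n%:R).
  move=> n0n n_gt0; apply: (rate_lt n_gt0 (erefl _)).
  apply: le_lt_trans hn0; apply: ereal_sup_ubound; exists n => //.
apply/cvgrPdist_le => eps eps0; have [m hm] := nat_gt (eps^-1 / c).
exists (maxn n0 m.+1) => // n /=; rewrite geq_max => /andP[n0n mn].
rewrite sub0r normrN ger0_norm //; apply: le_trans (le_exp n n0n (leq_trans _ mn)) _ => //.
rewrite mulNr expRN -[leRHS]invrK lef_pV2 ?posrE ?expR_gt0 ?invr_gt0 //.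
apply: le_trans (expR_ge1Dx _); apply: le_trans (_ : _ <= c * n%:R) _; last by rewrite lerDr.
by rewrite mulrC -ler_pdivrMr // (le_trans (ltW hm)) // ler_nat ltnW.
Qed.

Lemma cvg_rate_limsup (u : nat -> \bar R) l : u @ \oo --> l -> limn_esup u = l.
Proof. by move=> /cvg_limn_einf_sup[]. Qed.

End Rates.

(** * The top Oseledets line and the mean-zero vectors *)

Section Splitting.
Context {R : realType} {d : measure_display} {Om : measurableType d}.
Variable P : probability Om R.
Context {X : completeNormedModType R}.
Variables (s sinv : Om -> Om).
Hypothesis ms : measurable_fun setT s.
Hypothesis Ps : forall A, measurable A -> P (s @^-1` A) = P A.
Variables (wn I : X -> R) (CI : R) (e : X).
Hypothesis wnD : forall f g, wn (f + g) <= wn f + wn g.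
Hypothesis wnZ : forall a f, wn (a *: f) = `|a| * wn f.
Hypothesis I_lin : forall a f g, I (a *: f + g) = a * I f + I g.
Hypothesis I_wn : forall f, `|I f| <= CI * wn f.
Hypothesis Ie : I e = 1.
Variable L : Om -> X -> X.
Hypothesis linL : forall w, lin (L w).
Hypothesis ae_I : {ae P, forall w, forall f, I (L w f) = I f}.
Variable C : Om -> R.
Hypothesis weakL : {ae P, forall w, forall n f,
  wn (cocycle L s n w f) <= C (iter n s w) * wn f}.
Hypothesis temperedC : {ae P, forall w,
  rate (fun n => `|C (iter n s w)|%:E) @ \oo --> 0%E}.

Let weak_ge0 := wn_ge0 wnD wnZ.

Let decays w g := wn (cocycle L s n w g) @[n --> \oo] --> 0.

Let decays0 w : decays w 0.
Proof.
rewrite /decays; under eq_fun do rewrite (lin0 (cocycle_lin s linL _ _)) (wn0 wnZ).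
exact: cvg_cst.
Qed.

Let decaysD w f g : decays w f -> decays w g -> decays w (f + g).
Proof.
move=> df dg; apply: (@squeeze_cvgr _ _ _ _ (cst 0)
  (fun n => wn (cocycle L s n w f) + wn (cocycle L s n w g))).
- by apply: nearW => n; rewrite weak_ge0 /= linD //; exact: cocycle_lin.
- exact: cvg_cst.
- by rewrite -[X in _ --> X]addr0; exact: cvgD.
Qed.

Let decays_I w g : (forall n f, I (L (iter n s w) f) = I f) -> decays w g -> I g = 0.
Proof.
move=> hI dg; apply/eqP; rewrite -normr_le0.
have cv : CI * wn (cocycle L s n w g) @[n --> \oo] --> 0.
  by rewrite -(mulr0 CI); apply: cvgM; [exact: cvg_cst | exact: dg].
rewrite -(cvg_lim _ cv) //; apply: limr_ge; first by apply/cvg_ex; eexists; exact: cv.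
apply: nearW => n; rewrite -[I g](@cocycle_I _ _ _ _ s I L n w g); last by move=> ? ?; exact: hI.
exact: I_wn.
Qed.

(** For large [n] a positive exponent gives growth at least [expR (lam / 2 * n)], while temperedness
    of [C] allows at most [expR (lam / 4 * n) * wn g]. *)
Let growth_le0 w g (lam : R) :
  (forall n f, wn (cocycle L s n w f) <= C (iter n s w) * wn f) ->
  rate (fun n => `|C (iter n s w)|%:E) @ \oo --> 0%E ->
  rate (fun n => (wn (cocycle L s n w g))%:E) @ \oo --> lam%:E -> lam <= 0.
Proof.
move=> hw hC hg; rewrite leNgt; apply/negP => lam0.
have [N1 _ h1] : \forall n \near \oo,
    (rate (fun n => `|C (iter n s w)|%:E) n < (lam / 4)%:E)%E.
  apply: (hC [set x | (x < (lam / 4)%:E)%E]); apply: open_ereal_lt'.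
  by rewrite lte_fin divr_gt0.
have [N2 _ h2] : \forall n \near \oo,
    ((lam / 2)%:E < rate (fun n => (wn (cocycle L s n w g))%:E) n)%E.
  apply: (hg [set x | ((lam / 2)%:E < x)%E]); apply: open_ereal_gt'.
  by rewrite lte_fin; lra.
have [m hm] := nat_gt (wn g / (lam / 4)).
pose n := (maxn (maxn N1 N2) m).+1.
have n1 : (N1 <= n)%N by rewrite leqW // !leq_max leqnn.
have n2 : (N2 <= n)%N by rewrite leqW // !leq_max leqnn orbT.
have nm : (m <= n)%N by rewrite leqW // leq_max leqnn orbT.
have b1 := rate_lt (isT : (0 < n)%N) (erefl _) (h1 n n1).
have b2 := rate_gt (isT : (0 < n)%N) (erefl _) (h2 n n2).
have : expR (lam / 2 * n%:R) <= expR (lam / 4 * n%:R) * wn g.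
  apply: le_trans b2 _; apply: le_trans (hw n g) _.
  by rewrite ler_wpM2r //; apply: le_trans (ler_norm _) b1.
have -> : lam / 2 * n%:R = lam / 4 * n%:R + lam / 4 * n%:R by field.
rewrite expRD ler_pM2l ?expR_gt0 //; apply/negP; rewrite -ltNge.
apply: lt_le_trans (expR_ge1Dx _).
have : wn g < lam / 4 * n%:R.
  by rewrite mulrC -ltr_pdivrMr ?divr_gt0 // (lt_le_trans hm) // ler_nat.
lra.
Qed.

(** As the top exponent is at most 0, [f - PE 0 w f] decays and so has mean zero. Hence
    [I (PE 0 w e) = 1], [I] is injective on the line [E 0 w], and mean zero forces [PE 0 w f = 0].
    The equivariant family is the projection of [e]. *)
Lemma splitting_decay : splits_dimE1_one P wn s sinv L ->
  (exists F0, borel_meas F0 /\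
     {ae P, forall w, I (F0 w) = 1 /\ L w (F0 w) = F0 (s w)}) /\
  {ae P, forall w, decaying s wn I L w}.
Proof.
move=> [kappa [l [lam [dE [E [PE [V [PV [[_ hlam hE hV hdec] [v0 dE1]]]]]]]]]].
(* With finitely many exponents the cut comes after all of them, otherwise after the first. Either
   way the growth on the complement stays strictly below [lam 0]. *)
have [J [vJ J0 vj ltJ]] : exists J, [/\ valid_cut l J, (0 < J)%N,
    forall j, (j < J)%N -> valid_idx l j &
    ((if valid_idx l J then (lam J)%:E else kappa) < (lam 0%N)%:E)%E].
  case: l v0 hlam {hE hV hdec} => [n|] /= v0 hlam.
    by exists n; split=> //; rewrite ltnn; case: (hlam 0%N v0).
  by exists 1%N; split=> //; rewrite lte_fin; case: (hlam 0%N isT) => _ /(_ isT).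
case: J J0 vJ vj ltJ => // J _ vJ vj ltJ.
have lam_lt j : valid_idx l j.+1 -> lam j.+1 < lam 0%N.
  elim: j => [|j IHj] vj1; first by case: (hlam 0%N v0) => _ /(_ vj1).
  have vj' : valid_idx l j.+1 by move: vj1; case: (l) => //= n; exact: ltnW.
  by apply: lt_trans (IHj vj'); case: (hlam _ vj') => _ /(_ vj1).
have [dimE imE _ [mPE _] _] := hE 0%N v0.
have [_ _ growV _ rangeV] := hV J.+1 vJ.
have growE : {ae P, forall w, forall j, valid_idx l j -> (forall v, E j w v -> v != 0 ->
    rate (fun n => (wn (cocycle L s n w v))%:E) @ \oo --> (lam j)%:E) /\
    range (PE j w) = E j w}.
  apply: ae_foralln => j; have [vj'|nvj] := boolP (valid_idx l j); last first.
    exact: aeW.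
  have [_ _ g _ rg] := hE j vj'; apply: filterS2 g rg => w gw [_ rw] _; split => //.
pose Rw w := [/\ E 0%N w (PE 0%N w e), I (PE 0%N w e) = 1,
  forall g g', E 0%N w g -> E 0%N w g' -> I g = I g' -> g = g' & decaying s wn I L w].
have aeR : {ae P, forall w, Rw w}.
  have ae1 : {ae P, forall w, [/\ dim_eq (E 0%N w) 1,
      forall j, valid_idx l j -> (forall v, E j w v -> v != 0 ->
        rate (fun n => (wn (cocycle L s n w v))%:E) @ \oo --> (lam j)%:E) /\
        range (PE j w) = E j w &
      forall n f, I (L (iter n s w) f) = I f]}.
    apply: filterS3 dimE growE (ae_iter ms Ps ae_I) => w [dw _] gw iw; split=> //.
    by rewrite -dE1.
  have ae2 : {ae P, forall w, [/\ forall f, f = \sum_(j < J.+1) PE j w f + PV J.+1 w f,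
      range (PV J.+1 w) = V J.+1 w & forall v, V J.+1 w v ->
        (limn_esup (rate (fun n => (wn (cocycle L s n w v))%:E))
          <= (if valid_idx l J.+1 then (lam J.+1)%:E else kappa))%E]}.
    by apply: filterS3 (hdec J.+1 vJ) rangeV growV => w [dw _] [_ rw] gw; split.
  have ae3 : {ae P, forall w, (forall n f,
      wn (cocycle L s n w f) <= C (iter n s w) * wn f) /\
      rate (fun n => `|C (iter n s w)|%:E) @ \oo --> 0%E}.
    by apply: filterS2 weakL temperedC => w.
  apply: filterS3 ae1 ae2 ae3 => w [[v [Ev freev]] gE hI] [dec rV gV] [hw hC].
  have v_neq0 : v ord0 != 0.
    apply/eqP => v00; have := freev (fun=> 1); rewrite big_ord1 v00 scaler0.
    by move=> /(_ erefl ord0) /eqP; rewrite oner_eq0.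
  have lineE g : E 0%N w g -> exists c, g = c *: v ord0.
    by rewrite Ev => -[c _ <-]; exists (c ord0); rewrite big_ord1.
  have Ev0 : E 0%N w (v ord0).
    by rewrite Ev; exists (fun=> 1) => //; rewrite big_ord1 scale1r.
  have lam0 : lam 0%N <= 0.
    by have [gr _] := gE 0%N v0; exact: (growth_le0 hw hC (gr _ Ev0 v_neq0)).
  have rest f : decays w (f - PE 0%N w f).
    have -> : f - PE 0%N w f = \sum_(j < J) PE j.+1 w f + PV J.+1 w f.
      rewrite {1}(dec f) big_ord_recl -[X in X - _]addrA [LHS]addrC addKr.
      by congr (_ + _); apply: eq_bigr.
    apply: decaysD.
      apply: (big_ind (decays w)) => [||j _]; [exact: decays0 | exact: decaysD |].
      have vj1 : valid_idx l j.+1 by apply: vj; rewrite ltnS.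
      have [->|g0] := eqVneq (PE j.+1 w f) 0; first exact: decays0.
      have [grow rg] := gE _ vj1.
      have Ej : E j.+1 w (PE j.+1 w f) by rewrite -rg; exists f.
      apply: cvg0_of_rate => //; rewrite (cvg_rate_limsup (grow _ Ej g0)) lte_fin.
      exact: lt_le_trans (lam_lt j vj1) lam0.
    apply: cvg0_of_rate => //; apply: le_lt_trans (gV _ _) _.
      by rewrite -rV; exists f.
    by apply: lt_le_trans ltJ _; rewrite lee_fin.
  have I_PE f : I (PE 0%N w f) = I f.
    have := decays_I hI (rest f); rewrite (IB I_lin) => /eqP.
    by rewrite subr_eq0 => /eqP.
  have rgE f : E 0%N w (PE 0%N w f) by case: (gE 0%N v0) => _ <-; exists f.
  have Iv : I (v ord0) != 0.
    have [c hc] := lineE _ (rgE e); apply/eqP => Iv0.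
    have := I_PE e; rewrite hc (IZ I_lin) Iv0 mulr0 Ie => /esym/eqP.
    by rewrite oner_eq0.
  have injI g g' : E 0%N w g -> E 0%N w g' -> I g = I g' -> g = g'.
    move=> /lineE[c ->] /lineE[c' ->]; rewrite !(IZ I_lin).
    by move/(mulIf Iv) => ->.
  split=> //; first by rewrite I_PE.
  move=> f If; suff -> : f = f - PE 0%N w f by exact: rest.
  rewrite (injI (PE 0%N w f) 0) ?subr0 //.
    by rewrite Ev; exists (fun=> 0) => //; rewrite big_ord1 scale0r.
  by rewrite I_PE If (I0 I_lin).
split; last by apply: filterS aeR => w [].
exists (fun w => PE 0%N w e); split; first exact: mPE.
have := ae_iter ms Ps aeR; apply: filterS3 imE ae_I => w im hI hR.
have [Ew Iw _ _] := hR 0%N; have [Esw Isw inj _] := hR 1%N; split=> //.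
(* Both sides lie on the line [E 0 (s w)] and have integral 1. *)
apply: inj => //; last by rewrite hI Iw Isw.
by rewrite /= -im; exists (PE 0%N w e).
Qed.

End Splitting.

(** * Function spaces on an interval *)

Section FunctionSpace.
Context {R : realType} (a b : R) (X Y : completeNormedModType R).
Variables (jXY : X -> Y) (evY : Y -> R -> R).
Hypothesis setup : function_space_setup a b jXY evY.
Local Notation leb := (@lebesgue_measure R).
Local Notation ev := (evX jXY evY).
Local Notation wn := (weak_norm jXY).
Local Notation D := (Iab a b).

Let ab : 0 < b - a. Proof. by case: setup => ab _ _ _ _; rewrite subr_gt0. Qed.

Lemma IabE : D = [set` `[a, b]].
Proof. by apply/seteqP; split=> x; rewrite /Iab /= in_itv. Qed.

Let mD : measurable (D : set (measurableTypeR R)).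
Proof. by rewrite IabE; exact: measurable_itv. Qed.

Let ae_imp (Q Q' : R -> Prop) : (forall x, Q x -> Q' x) ->
  {ae leb, forall x, Q x} -> {ae leb, forall x, Q' x}.
Proof. by move=> QQ' [N [mN N0 QN]]; exists N; split=> // x nQ'; apply: QN => /QQ'. Qed.

Lemma embedZD c f g : jXY (c *: f + g) = c *: jXY f + jXY g.
Proof. by case: setup => _ [h _] _ _ _. Qed.

Lemma embedD f g : jXY (f + g) = jXY f + jXY g.
Proof. by have := embedZD 1 f g; rewrite !scale1r. Qed.

Lemma embed0 : jXY 0 = 0.
Proof. by have := embedD 0 0; rewrite addr0 => /esym/eqP; rewrite -subr_eq0 addrK => /eqP. Qed.

Lemma embedZ c f : jXY (c *: f) = c *: jXY f.
Proof. by have := embedZD c f 0; rewrite embed0 !addr0. Qed.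

Lemma weak_normD f g : wn (f + g) <= wn f + wn g.
Proof. by rewrite /weak_norm embedD ler_normD. Qed.

Lemma weak_normZ c f : wn (c *: f) = `|c| * wn f.
Proof. by rewrite /weak_norm embedZ normrZ. Qed.

Lemma weak_norm_eq0 f : wn f = 0 -> f = 0.
Proof.
move=> /eqP; rewrite normr_eq0 => /eqP jf0; case: setup => _ [_ inj] _ _ _.
by apply: inj; rewrite jf0 embed0.
Qed.

Lemma weak_norm_bounded : exists2 J : R, 0 <= J & forall f, wn f <= J * `|f|.
Proof.
case: setup => _ _ cpt _ _; have [M [_ hM]] := compact_bounded cpt.
pose J := `|M| + 1; have J0 : 0 <= J by rewrite addr_ge0.
have ball1 f : `|f| <= 1 -> wn f <= J.
  move=> f1; apply: (hM J); first by rewrite /J (le_lt_trans (ler_norm M)) // ltrDl.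
  by apply: subset_closure; exists f.
exists J => // f; have [->|f0] := eqVneq f 0; first by rewrite /weak_norm embed0 !normr0 mulr0.
have nf : 0 < `|f| by rewrite normr_gt0.
have := ball1 (`|f|^-1 *: f); rewrite weak_normZ normrZ normfV normr_id mulVf ?gt_eqF //.
by move=> /(_ (lexx _)); rewrite ler_pdivrMl // mulrC.
Qed.

Lemma evZD c f g x : ev (c *: f + g) x = c * ev f x + ev g x.
Proof. by rewrite /evX embedZD; case: setup => _ _ _ [h _] _; rewrite h. Qed.

Lemma evB f g x : ev (f - g) x = ev f x - ev g x.
Proof. by rewrite addrC -scaleN1r evZD mulN1r addrC. Qed.

Lemma integrable_ev f : leb.-integrable D (fun x => (ev f x)%:E).
Proof. by case: setup => _ _ _ [_ [h _]] _; exact: h. Qed.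

Let mev f : measurable_fun (D : set (measurableTypeR R)) (fun x => (ev f x)%:E).
Proof. exact: measurable_int (integrable_ev f). Qed.

Lemma integral_norm_ev : exists2 C : R, 0 <= C & forall f,
  (\int[leb]_(x in D) `|ev f x|%:E <= (C * wn f)%:E)%E.
Proof.
case: setup => _ _ _ [_ [_ [C hC]]] _; exists `|C| => // f.
by apply: le_trans (hC (jXY f)) _; rewrite lee_fin ler_wpM2r // ler_norm.
Qed.

Lemma intm_lin c f g : intm a b (ev (c *: f + g)) = c * intm a b (ev f) + intm a b (ev g).
Proof.
rewrite /intm mulrA -mulrDl; congr (_ / _).
have -> : (\int[leb]_(x in D) (ev (c *: f + g) x)%:E =
    \int[leb]_(x in D) (c%:E * (ev f x)%:E + (ev g x)%:E))%E.
  by apply: eq_integral => x _; rewrite evZD EFinD EFinM.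
rewrite integralD //; [|exact: integrableZl (integrable_ev f) | exact: integrable_ev].
rewrite integralZl //; last exact: integrable_ev.
have ff := integrable_fin_num mD (integrable_ev f).
have fg := integrable_fin_num mD (integrable_ev g).
by rewrite fineD ?fineM // fin_numM.
Qed.

Definition negpart (f : X) : R := fine (\int[leb]_(x in D) (Num.max (- ev f x) 0)%:E)%E.

Let integrable_negpart f : leb.-integrable D (fun x => (Num.max (- ev f x) 0)%:E).
Proof.
apply: (le_integrable mD _ _ (integrable_ev f)).
  apply/measurable_EFinP; apply: measurable_maxr; last exact: measurable_cst.
  by apply: measurable_funN; apply/measurable_EFinP; exact: mev.
move=> x _ /=; rewrite lee_fin ger0_norm ?le_max ?lexx ?orbT // ge_max normr_ge0 andbT.
by rewrite -normrN ler_norm.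
Qed.

Lemma negpart_ge0 f : 0 <= negpart f.
Proof. by apply: fine_ge0; apply: integral_ge0 => x _; rewrite lee_fin le_max lexx orbT. Qed.

Lemma negpartP f : nonneg_fun a b (ev f) <-> negpart f = 0.
Proof.
have mn : measurable_fun (D : set (measurableTypeR R)) (fun x => (Num.max (- ev f x) 0)%:E).
  exact: measurable_int (integrable_negpart f).
have -> : negpart f = fine (\int[leb]_(x in D) `|(Num.max (- ev f x) 0)%:E|)%E.
  congr fine; apply: eq_integral => x _; rewrite gee0_abs // lee_fin le_max lexx orbT //.
have fin : (\int[leb]_(x in D) `|(Num.max (- ev f x) 0)%:E| \is a fin_num)%E.
  by move: (integrable_fin_num mD (integrable_abse (integrable_negpart f))).
split=> [nn|/eqP].
  suff -> : (\int[leb]_(x in D) `|(Num.max (- ev f x) 0)%:E| = 0)%E by [].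
  apply/(ae_eq_integral_abs _ mD mn); apply: ae_imp nn => x nnx Dx /=.
  by rewrite max_r // oppr_le0 nnx.
rewrite -eqe fineK // => /eqP/(ae_eq_integral_abs _ mD mn).
apply: ae_imp => x h Dx; move: (h Dx) => /= [].
by case: (leP (- ev f x) 0); lra.
Qed.

Lemma integral_bounds : exists2 CI : R, 0 <= CI &
  (forall f, `|intm a b (ev f)| <= CI * wn f) /\
  (forall f g, negpart f <= negpart g + CI * wn (f - g)).
Proof.
have [C C0 hC] := integral_norm_ev.
have ab0 : 0 <= (b - a)^-1 by rewrite invr_ge0 ltW.
(* One constant for both bounds: the normalised integral needs [C / (b - a)], the unnormalised
   [negpart] needs [C]. *)
exists (C * (1 + (b - a)^-1)); first by rewrite mulr_ge0 // addr_ge0.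
have norm_fin f : (\int[leb]_(x in D) `|ev f x|%:E \is a fin_num)%E.
  by move: (integrable_fin_num mD (integrable_abse (integrable_ev f))).
have mabs h : measurable_fun (D : set (measurableTypeR R)) (fun x => `|ev h x|%:E).
  exact: measurable_int (integrable_abse (integrable_ev h)).
split=> [f|f g].
  rewrite /intm normrM [`|_^-1|]ger0_norm // mulrDr mulr1 mulrDl.
  apply: le_trans (_ : _ <= C / (b - a) * wn f) _; last first.
    by rewrite lerDr mulr_ge0 // /weak_norm.
  rewrite mulrAC ler_wpM2r // -lee_fin; apply: le_trans (hC f).
  have fin := integrable_fin_num mD (integrable_ev f).
  by rewrite -abse_EFin fineK //; exact: le_abse_integral (mev f).
apply: le_trans (_ : _ <= negpart g + C * wn (f - g)) _; last first.
  rewrite lerD2l ler_wpM2r ?ler_peMr // ?lerDl //; exact: normr_ge0.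
rewrite -lee_fin EFinD; apply: le_trans (leeD (lexx _) (hC (f - g))).
have finn h : (\int[leb]_(x in D) (Num.max (- ev h x) 0)%:E \is a fin_num)%E.
  by move: (integrable_fin_num mD (integrable_negpart h)).
have mneg h : measurable_fun (D : set (measurableTypeR R)) (fun x => (Num.max (- ev h x) 0)%:E).
  exact: measurable_int (integrable_negpart h).
have neg0 h x : D x -> (0 <= (Num.max (- ev h x) 0)%:E)%E.
  by rewrite lee_fin le_max lexx orbT.
rewrite /negpart !fineK // -ge0_integralD //; last by move=> x; exact: neg0.
apply: ge0_le_integral => //.
- by move=> x; exact: neg0.
- exact: emeasurable_funD.
move=> x _; rewrite -EFinD lee_fin evB ge_max; apply/andP; split; last first.
  by rewrite addr_ge0 // le_max lexx orbT.
have h1 : - ev g x <= Num.max (- ev g x) 0 by rewrite le_max lexx.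
by have := ler_norm (- (ev f x - ev g x)); rewrite normrN; lra.
Qed.

Lemma one_intm u : {ae leb, forall x, D x -> ev u x = 1} ->
  intm a b (ev u) = 1 /\ nonneg_fun a b (ev u).
Proof.
move=> u1; split; last by apply: ae_imp u1 => x h Dx; rewrite h.
rewrite /intm.
have -> : (\int[leb]_(x in D) (ev u x)%:E = \int[leb]_(x in D) (cst 1) x)%E.
  apply: (@ae_eq_integral _ (measurableTypeR R) R leb D (cst 1%E) _ mD (mev u)).
    exact: measurable_cst.
  by apply: ae_imp u1 => x h Dx; rewrite /= h.
have lebD : leb D = (b - a)%:E.
  rewrite IabE; apply: etrans (lebesgue_measure_itv _) _.
  by rewrite /= lte_fin -subr_gt0 ab.
have -> : (\int[leb]_(x in D) (cst 1) x = (b - a)%:E)%E.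
  by apply: etrans (integral_cst _ mD 1%E) _; rewrite mul1e; exact: lebD.
by rewrite divff // gt_eqF.
Qed.

(** The subcover is taken for the image of the mean-zero part [S] of the unit ball, with centres in
    [S]; this gives the net elements mean zero. *)
Lemma weak_nets (I : X -> R) (eps : R) : 0 < eps -> exists fs : seq X,
  (forall g, g \in fs -> I g = 0) /\
  forall f, I f = 0 -> `|f| <= 1 -> exists2 g, g \in fs & wn (f - g) <= eps.
Proof.
move=> eps0; pose S := [set f : X | I f = 0 /\ `|f| <= 1].
have : compact (closure (jXY @` S)).
  case: setup => _ _ cpt _ _; apply: subclosed_compact cpt _; first exact: closed_closure.
  by apply: closure_subset => _ [f [_ f1] <-]; exists f.
rewrite compact_cover => cpt.
have [|y clS|fs fsS cov] := cpt X S (fun f => ball (jXY f) eps).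
- by move=> f _; exact: ball_open.
- have [_ [[f Sf <-] fy]] := clS _ (nbhsx_ballx y eps eps0).
  by exists f => //; exact: ball_sym.
exists (finmap.enum_fset fs); split=> [g gfs|f If f1].
  by have [] : S g by have := fsS g gfs; rewrite inE.
have [|g gfs] := cov (jXY f); first by apply: subset_closure; exists f.
rewrite -ball_normE /= => hg; exists g => //; rewrite /weak_norm.
have -> : jXY (f - g) = jXY f - jXY g by rewrite embedD -scaleN1r embedZ scaleN1r.
by rewrite distrC ltW.
Qed.

End FunctionSpace.

(** * From one null set per vector to one null set for all vectors *)

Section AlmostEveryOperator.
Context {R : realType} {d : measure_display} {Om : measurableType d}.
Variable P : probability Om R.
Context {X : completeNormedModType R}.
Variable u : nat -> X.
Hypothesis du : dense (range u).
Variable A : Om -> X -> X.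
Hypothesis linA : forall w, lin (A w).
Hypothesis bA : forall w, bounded_op (A w).

Lemma ae_forall_preserves (phi : X -> R) : continuous phi ->
  (forall f, {ae P, forall w, phi (A w f) = phi f}) ->
  {ae P, forall w, forall f, phi (A w f) = phi f}.
Proof.
move=> cphi hphi; have := ae_foralln (fun i => hphi (u i)); apply: filterS => w h f.
have cA : continuous (fun f => phi (A w f)).
  by move=> g; apply: continuous_comp; [exact: bounded_op_continuous | exact: cphi].
apply/eqP; rewrite eq_le; apply/andP; split.
  by apply: (le_of_dense (phi := fun f => phi (A w f)) du) => // i; rewrite h.
by apply: (le_of_dense (psi := fun f => phi (A w f)) du) => // i; rewrite h.
Qed.

(** The dense sequence need not meet the cone, so a countable family inside the cone is chosen:
    [v (i, m)] is within [1/(m+1)] of [u i] whenever a cone element is. The Lipschitz functional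
    [negp] carries the property to the rest of the cone. *)
Lemma ae_forall_cone (NN : X -> Prop) (negp : X -> R) (c : R) : NN 0 -> 0 <= c ->
  (forall f, NN f <-> negp f = 0) -> (forall f, 0 <= negp f) ->
  (forall f g, negp f <= negp g + c * `|f - g|) ->
  (forall f, {ae P, forall w, NN f -> NN (A w f)}) ->
  {ae P, forall w, forall f, NN f -> NN (A w f)}.
Proof.
move=> NN0 c0 negpP negp_ge0 lip hA.
pose near i m f := NN f /\ `|f - u i| < m.+1%:R^-1.
have /choice[v hv] : forall im : nat * nat, exists f,
    NN f /\ ((exists g, near im.1 im.2 g) -> near im.1 im.2 f).
  move=> [i m] /=; have [[g hg]|no] := pselect (exists g, near i m g).
    by exists g; split=> //; case: hg.
  by exists 0.
have : {ae P, forall w, forall i m, NN (A w (v (i, m)))}.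
  apply: ae_foralln => i; apply: ae_foralln => m; apply: filterS (hA (v (i, m))) => w.
  by apply; case: (hv (i, m)).
apply: filterS => w h f NNf; apply/negpP/eqP; rewrite eq_le negp_ge0 andbT.
have [c' hc'] := bA w; rewrite leNgt; apply/negP => pos.
(* [C] dominates the Lipschitz constant of [negp] composed with [A w]; [m] makes [2C/(m+1)] smaller
   than the supposed positive value. *)
pose C := c * `|c'| + 1; have C0 : 0 < C by rewrite ltr_wpDl // mulr_ge0.
have [m hm] := nat_gt (2 * C / negp (A w f)).
have m0 : 0 < m.+1%:R^-1 :> R by rewrite invr_gt0 ltr0Sn.
have [i hi] := dense_near f du m0.
have [_ [//|_ hvi]] := hv (i, m); first by exists f.
have hdist : `|f - v (i, m)| < 2 * m.+1%:R^-1.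
  apply: le_lt_trans (ler_distD (u i) _ _) _; rewrite [`|u i - _|]distrC.
  by move: hi hvi; rewrite /=; move: (m.+1%:R^-1) => q; lra.
have := lip (A w f) (A w (v (i, m))); have /negpP -> := h i m; rewrite add0r -linB //.
apply/negP; rewrite -ltNge.
apply: le_lt_trans (_ : _ <= C * `|f - v (i, m)|) _.
  apply: le_trans (ler_wpM2l c0 (hc' _)) _; rewrite mulrA ler_wpM2r //.
  by apply: le_trans (_ : _ <= c * `|c'|) _; [rewrite ler_wpM2l // ler_norm | rewrite lerDl].
apply: lt_trans (_ : _ < C * (2 * m.+1%:R^-1)) _; first by rewrite ltr_pM2l.
rewrite mulrA [C * 2]mulrC ltr_pdivrMr ?ltr0Sn // [ltRHS]mulrC -ltr_pdivrMr //.
by apply: lt_trans hm _; rewrite ltr_nat.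
Qed.

End AlmostEveryOperator.

(** * Almost sure bounds in the strong norm *)

Lemma opnorm_le_bound {R : realType} {X : completeNormedModType R} (nrm : X -> R)
    (T : X -> X) (M : R) f : lin T ->
  (forall c g, nrm (c *: g) = `|c| * nrm g) -> (forall g, 0 <= nrm g) ->
  (forall g, nrm g = 0 -> g = 0) -> (opnorm nrm T <= M%:E)%E ->
  nrm (T f) <= M * nrm f.
Proof.
move=> linT nrmZ nrm0 nrm_eq0 hM; have [->|f0] := eqVneq f 0.
  have -> : T 0 = 0 by exact: lin0.
  have -> : nrm 0 = 0 by rewrite -(scale0r (0 : X)) nrmZ normr0 mul0r.
  by rewrite mulr0.
have nf : 0 < nrm f.
  by rewrite lt_neqAle nrm0 andbT eq_sym; apply: contra f0 => /eqP/nrm_eq0 ->.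
have : ((nrm (T ((nrm f)^-1 *: f)))%:E <= M%:E)%E.
  apply: le_trans hM; apply: ereal_sup_ubound; exists ((nrm f)^-1 *: f) => //=.
  by rewrite nrmZ ger0_norm ?invr_ge0 // mulVf ?gt_eqF.
rewrite lee_fin linZ // nrmZ ger0_norm ?invr_ge0 //.
by rewrite ler_pdivrMl // mulrC.
Qed.

Lemma subexponential_growth {R : realType} (C : nat -> R) (c : R) : 0 < c ->
  rate (fun n => `|C n|%:E) @ \oo --> 0%E ->
  exists K : R, forall n, `|C n| <= K * expR (c * n%:R).
Proof.
move=> c0 hC.
have [N _ hN] : \forall n \near \oo, (rate (fun n => `|C n|%:E) n < c%:E)%E.
  by apply: (hC [set x | (x < c%:E)%E]); apply: open_ereal_lt'; rewrite lte_fin.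
pose S := \sum_(i < N.+1) `|C i|; have S0 : 0 <= S by exact: sumr_ge0.
exists (1 + S) => n; have e1 : 1 <= expR (c * n%:R).
  by rewrite -expR0 ler_expR mulr_ge0 // ltW.
have [nN|Nn] := ltnP n N.+1.
  apply: le_trans (_ : _ <= S) _.
    by rewrite /S (bigD1 (Ordinal nN)) //= lerDl sumr_ge0.
  rewrite -[leLHS]mulr1; apply: ler_pM => //; first by rewrite lerDr.
have n_gt0 : (0 < n)%N by exact: leq_trans Nn.
have := rate_lt n_gt0 (erefl _) (hN n (ltnW Nn)) => /le_trans; apply.
by rewrite ler_peMl ?expR_ge0 // lerDl.
Qed.

Lemma exp_decay_small {R : realType} (K c eps : R) : 0 < c -> 0 < eps ->
  exists m : nat, K * expR (- (c * m%:R)) <= eps.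
Proof.
move=> c0 eps0; have [m hm] := nat_gt (`|K| / eps / c); exists m.
rewrite expRN ler_pdivrMr ?expR_gt0 // -ler_pdivrMl //; apply: le_trans (expR_ge1Dx _).
apply: le_trans (_ : _ <= c * m%:R) _; last by rewrite lerDr.
rewrite [leRHS]mulrC -ler_pdivrMr // (le_trans _ (ltW hm)) //.
by rewrite ler_pM2r ?invr_gt0 // mulrC ler_pM2r ?invr_gt0 // ler_norm.
Qed.

(** Along backward orbits the products of [alpha] decay at some rate [g], while temperedness lets
    [C] grow at rate at most [g / 2]; so the iterated Lasota-Yorke bound stays bounded in [n]. *)
Lemma ae_pullback_bound {R : realType} {d : measure_display} {Om : measurableType d}
    (P : probability Om R) (X : completeNormedModType R) (s sinv : Om -> Om)
    (Lk : nat -> Om -> X -> X) (wn : X -> R) (J B : R) (alpha C : Om -> R) (e : X) :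
  cancel s sinv -> cancel sinv s ->
  measurable_fun setT s -> measurable_fun setT sinv ->
  (forall A, measurable A -> P (s @^-1` A) = P A) ->
  (forall A, measurable A -> s @^-1` A = A -> P A = 0%E \/ P A = 1%E) ->
  0 <= J -> (forall f, wn f <= J * `|f|) -> 0 < wn e -> 0 <= B ->
  measurable_fun setT alpha -> (forall w, 0 <= alpha w) ->
  (\int[P]_w (logplus (alpha w))%:E < +oo)%E -> (\int[P]_w elog (alpha w)%:E < 0)%E ->
  {ae P, forall w, lasota_yorke Lk wn alpha B w} ->
  {ae P, forall w, pullback_bound s sinv Lk wn w (C w)} ->
  {ae P, forall w, rate (fun n => `|C (iter n sinv w)|%:E) @ \oo --> 0%E} ->
  {ae P, forall w, exists M : nat, pullback_bound s sinv Lk (fun f : X => `|f|) w M%:R}.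
Proof.
move=> sK sinvK ms msinv Ps ergs J0 wnJ wne B0 malpha alpha0 intp intn aeLY aeWB aeC.
have Psinv := preserving_inv sK msinv Ps; have ergsinv := ergodic_inv sK ergs.
have [g g0 aeprod] := contracting_products malpha alpha0 intp intn msinv Psinv ergsinv.
(* The backward products start at [alpha (sinv w)], so both facts are needed at [sinv w]. *)
have ae1 := ae_iter msinv Psinv aeprod; have ae2 := ae_iter msinv Psinv aeC.
have ae12 : {ae P, forall w, (exists K : R, forall n,
    \prod_(i < n) alpha (iter i sinv (sinv w)) <= K * expR (- (g * n%:R))) /\
    rate (fun n => `|C (iter n sinv (sinv w))|%:E) @ \oo --> 0%E}.
  by apply: filterS2 ae1 ae2 => w /(_ 1%N) h1 /(_ 1%N) h2.
have g2 : 0 < g / 2 by rewrite divr_gt0.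
apply: filterS3 ae12 (ae_iter msinv Psinv aeLY) (ae_iter msinv Psinv aeWB) => w [[K hK] hC] ly wb.
(* The bound with [n = 0], tested on a vector of positive weak norm, even gives [1 <= C]. *)
have C0 m : 0 <= C (iter m sinv w).
  have := wb m 0%N 0%N e; rewrite /= -[leLHS]mul1r ler_pM2r //.
  exact: le_trans.
have [K' hK'] := subexponential_growth g2 hC.
have [n|n|n|n|M hM] := @bounded_pullback_sum R J J0 B B0
  (fun n => \prod_(i < n) alpha (iter i.+1 sinv w)) (fun j => C (iter j.+1 sinv w)) g K K' g0.
- exact: prodr_ge0.
- exact: C0.
- by under eq_bigr do rewrite iterSr; exact: hK.
- by rewrite iterSr; apply: le_trans (ler_norm _) (hK' n).
have [M' hM'] := nat_gt M; exists M' => k n f.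
apply: le_trans (lasota_yorke_pullback sinvK wnJ alpha0 B0 n ly wb C0 k f) _.
by rewrite ler_wpM2r // (le_trans (hM n)) // ltW.
Qed.

(** * Verification of the abstract hypotheses and assembly *)

Theorem theorem2p12 (R : realType) (d : measure_display) (Om : measurableType d)
  (P : probability Om R) (s sinv : Om -> Om) (a b : R)
  (X Y : completeNormedModType R) (jXY : X -> Y) (evY : Y -> R -> R)
  (L : Om -> X -> X) (Lk : nat -> Om -> X -> X) :
  lebesgue_space P ->
  ergodic_invertible_base P s sinv ->
  function_space_setup a b jXY evY ->
  linear_rds L ->
  (forall k, linear_rds (Lk k)) ->
  (* (H0) *)
  (\int[P]_w (logplus (fine (opnorm (fun f : X => `|f|) (L w))))%:E < +oo)%E ->
  (forall k,
     (\int[P]_w (logplus (fine (opnorm (fun f : X => `|f|) (Lk k w))))%:E < +oo)%E) ->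
  (forall k (f : X), {ae P, forall w,
     [/\ nonneg_fun a b (evX jXY evY f) -> nonneg_fun a b (evX jXY evY (Lk k w f)),
         nonneg_fun a b (evX jXY evY f) -> nonneg_fun a b (evX jXY evY (L w f)),
         intm a b (evX jXY evY (Lk k w f)) = intm a b (evX jXY evY f) &
         intm a b (evX jXY evY (L w f)) = intm a b (evX jXY evY f)]}) ->
  (* (H1) *)
  (exists (B : R) (alpha : Om -> R),
     [/\ 0 < B, measurable_fun setT alpha, (forall w, 0 <= alpha w),
         (\int[P]_w (logplus (alpha w))%:E < +oo)%E /\
         (\int[P]_w elog (alpha w)%:E < 0)%E &
         forall (f : X) k, {ae P, forall w,
           `|Lk k w f| <= alpha w * `|f| + B * weak_norm jXY f}]) ->
  (* (H2) *)
  ({ae P, forall w,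
      ereal_sup [set opnorm (weak_norm jXY) (cocycle (Lk kn.1) s kn.2 (iter kn.2 sinv w))
                | kn in [set: nat * nat]] \is a fin_num} /\
   tempered P s sinv (fun w =>
      fine (ereal_sup [set opnorm (weak_norm jXY)
                             (cocycle (Lk kn.1) s kn.2 (iter kn.2 sinv w))
                      | kn in [set: nat * nat]]))) ->
  (* (H3) *)
  (exists tau : nat -> R, tau @ \oo --> 0 /\
     forall k, {ae P, forall w, forall g : X, `|g| = 1 ->
        weak_norm jXY (L w g - Lk k w g) <= tau k}) ->
  (* 1 \in X *)
  (exists u : X, {ae lebesgue_measure, forall x, Iab a b x -> evX jXY evY u x = 1}) ->
  (* R splits w.r.t. |.| and dim E_1 = 1 *)
  splits_dimE1_one P (weak_norm jXY) s sinv L ->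
  (* conclusion *)
  (exists F, random_acim P a b (evX jXY evY) sinv L F /\
     forall G, random_acim P a b (evX jXY evY) sinv L G -> {ae P, forall w, G w = F w}) /\
  (exists K : nat,
     (forall k, (K <= k)%N -> exists Fk, random_acim P a b (evX jXY evY) sinv (Lk k) Fk /\
        forall G, random_acim P a b (evX jXY evY) sinv (Lk k) G ->
          {ae P, forall w, G w = Fk w}) /\
     forall (F : Om -> X) (Fk : nat -> Om -> X),
       random_acim P a b (evX jXY evY) sinv L F ->
       (forall k, (K <= k)%N -> random_acim P a b (evX jXY evY) sinv (Lk k) (Fk k)) ->
       {ae P, forall w, (fun k => weak_norm jXY (F w - Fk k w)) @ \oo --> 0}).
Proof.
move=> _ [[sK sinvK] ms msinv Ps ergs] setup [[u du] mL linL finL] rdsLk _ _ H0.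
move=> [B [alpha [B_gt0 malpha alpha0 [intp intn] LY]]] [C_fin C_temp].
move=> [tau [tau_cvg Htau]] [e e1] splitting.
have mLk k : strongly_meas (Lk k) by case: (rdsLk k).
have linLk k w : lin (Lk k w) by case: (rdsLk k).
have bL w : bounded_op (L w) by exact: opnorm_fin_bounded.
have bLk k w : bounded_op (Lk k w) by apply: opnorm_fin_bounded => //; case: (rdsLk k).
pose wn := weak_norm jXY; pose I f := intm a b (evX jXY evY f).
pose NN f := nonneg_fun a b (evX jXY evY f).
have wnD : forall f g, wn (f + g) <= wn f + wn g := weak_normD setup.
have wnZ : forall c f, wn (c *: f) = `|c| * wn f := weak_normZ setup.
have wn_eq0 : forall f, wn f = 0 -> f = 0 := weak_norm_eq0 setup.
have wn_ge0' := wn_ge0 wnD wnZ.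
have [J J0 wnJ] := weak_norm_bounded setup.
have I_lin : forall c f g, I (c *: f + g) = c * I f + I g := intm_lin setup.
have [CI CI0 [I_wn negp_lip]] := integral_bounds setup.
have negpP : forall f, NN f <-> negpart a b jXY evY f = 0 := negpartP setup.
have negp_ge0 := negpart_ge0 a b jXY evY.
have [Ie NNe] : I e = 1 /\ NN e := one_intm setup e1.
have nets := weak_nets setup I.
have B0 := ltW B_gt0.
have wne : 0 < wn e.
  rewrite lt_neqAle wn_ge0' andbT eq_sym; apply/eqP => /wn_eq0 e0.
  by have /eqP := Ie; rewrite e0 (I0 I_lin) eq_sym oner_eq0.
have cI := I_continuous wnJ I_lin I_wn CI0.
have cwn := wn_continuous wnD wnJ.
have NN0 : NN 0.
  by apply: aeW => x _; rewrite -(scale0r (0 : X)) -[_ *: _]addr0 (evZD setup) mul0r add0r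
    -(subrr (0 : X)) (evB setup) subrr.
have lip f g : negpart a b jXY evY f <= negpart a b jXY evY g + CI * J * `|f - g|.
  by apply: le_trans (negp_lip f g) _; rewrite lerD2l -mulrA ler_wpM2l.
have CJ0 : 0 <= CI * J by exact: mulr_ge0.
have aeIk : {ae P, forall w, forall k f, I (Lk k w f) = I f}.
  apply: ae_foralln => k; apply: (ae_forall_preserves du) => // f.
  by apply: filterS (H0 k f) => w [].
have aeI : {ae P, forall w, forall f, I (L w f) = I f}.
  by apply: (ae_forall_preserves du) => // f; apply: filterS (H0 0%N f) => w [].
have aeNk : {ae P, forall w, forall k f, NN f -> NN (Lk k w f)}.
  apply: ae_foralln => k; apply: (ae_forall_cone du _ _ NN0 CJ0 negpP negp_ge0 lip) => // f.
  by apply: filterS (H0 k f) => w [].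
have aeN : {ae P, forall w, forall f, NN f -> NN (L w f)}.
  apply: (ae_forall_cone du _ _ NN0 CJ0 negpP negp_ge0 lip) => // f.
  by apply: filterS (H0 0%N f) => w [].
have aeLY : {ae P, forall w, lasota_yorke Lk wn alpha B w}.
  apply: ae_foralln => k; have := ae_foralln (fun i => LY (u i) k).
  apply: filterS => w h.
  apply: (le_of_dense (phi := fun f => `|Lk k w f|)
    (psi := fun f => alpha w * `|f| + B * wn f) du) => //.
    by move=> f; apply: cvg_norm; exact: bounded_op_continuous.
  move=> f; apply: cvgD; apply: cvgM; [exact: cvg_cst| exact: cvg_norm|exact: cvg_cst|exact: cwn].
pose C w := fine (ereal_sup [set opnorm (weak_norm jXY)
  (cocycle (Lk kn.1) s kn.2 (iter kn.2 sinv w)) | kn in [set: nat * nat]]).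
have aeWB : {ae P, forall w, pullback_bound s sinv Lk wn w (C w)}.
  apply: filterS C_fin => w finw k n f; apply: opnorm_le_bound => //.
    exact: cocycle_lin.
  rewrite /C fineK //; apply: ereal_sup_ubound; by exists (k, n).
have aeCs : {ae P, forall w, rate (fun n => `|C (iter n s w)|%:E) @ \oo --> 0%E}.
  by apply: filterS C_temp => w [].
have aeCi : {ae P, forall w, rate (fun n => `|C (iter n sinv w)|%:E) @ \oo --> 0%E}.
  by apply: filterS C_temp => w [].
have aeSB := ae_pullback_bound sK sinvK ms msinv Ps ergs J0 wnJ wne B0
  malpha alpha0 intp intn aeLY aeWB aeCi.
(* Absolute values make the sequence non-negative outright, with the same limit and a weaker
   bound. *)
pose tau' k := `|tau k|.
have tau'0 k : 0 <= tau' k by exact: normr_ge0.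
have tau'_cvg : tau' @ \oo --> 0.
  by rewrite -(normr0 R); exact: cvg_norm.
have aetau : {ae P, forall w, forall k f, wn (L w f - Lk k w f) <= tau' k * `|f|}.
  apply: ae_foralln => k; apply: filterS (Htau k) => w h f.
  have [->|f0] := eqVneq f 0.
    by rewrite (lin0 (linL w)) (lin0 (linLk k w)) subr0 (wn0 wnZ) normr0 mulr0.
  have nf : 0 < `|f| by rewrite normr_gt0.
  have := h (`|f|^-1 *: f); rewrite normrZ normfV normr_id mulVf ?gt_eqF // => /(_ erefl).
  rewrite (linZ _ _ (linL w)) (linZ _ _ (linLk k w)) -scalerBr -/(wn _) wnZ normfV normr_id.
  rewrite ler_pdivrMl // mulrC => /le_trans; apply.
  by rewrite ler_wpM2r // ler_norm.
(* The contracting block needs the products along forward orbits; [aeSB] rests on the backward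
   ones. *)
have [g g0 aeprod] := contracting_products malpha alpha0 intp intn ms Ps ergs.
pose gd := good s sinv wn I NN L Lk alpha B tau'.
have ae_good : {ae P, forall w, orbitwise s sinv gd w}.
  apply: (ae_orbitwise sK ms msinv Ps).
  have ae1 : {ae P, forall w, (forall k f, I (Lk k w f) = I f) /\ (forall f, I (L w f) = I f)}.
    by apply: filterS2 aeIk aeI => w.
  have ae2 : {ae P, forall w, (forall k f, NN f -> NN (Lk k w f)) /\
      (forall f, NN f -> NN (L w f))} by apply: filterS2 aeNk aeN => w.
  have ae3 : {ae P, forall w, (exists M : nat, pullback_bound s sinv Lk wn w M%:R) /\
      (exists M : nat, pullback_bound s sinv Lk (fun f : X => `|f|) w M%:R)}.
    apply: filterS2 aeWB aeSB => w wb sb; split=> //; have [M hM] := nat_gt (C w).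
    by exists M; apply: pullback_bound_le wb => //; exact: ltW.
  have ae4 : {ae P, forall w, lasota_yorke Lk wn alpha B w /\
      (forall eps : R, 0 < eps -> exists m, \prod_(i < m) alpha (iter i s w) <= eps)}.
    apply: filterS2 aeLY aeprod => w ly [K hK]; split=> // eps eps0.
    have [m hm] := exp_decay_small K g0 eps0; exists m; exact: le_trans (hK m) hm.
  have ae12 : {ae P, forall w, ((forall k f, I (Lk k w f) = I f) /\
      (forall f, I (L w f) = I f)) /\ ((forall k f, NN f -> NN (Lk k w f)) /\
      (forall f, NN f -> NN (L w f)))} by apply: filterS2 ae1 ae2 => w.
  have ae34 : {ae P, forall w, (lasota_yorke Lk wn alpha B w /\
      (forall eps : R, 0 < eps -> exists m, \prod_(i < m) alpha (iter i s w) <= eps)) /\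
      ((exists M : nat, pullback_bound s sinv Lk wn w M%:R) /\
      (exists M : nat, pullback_bound s sinv Lk (fun f : X => `|f|) w M%:R))}.
    by apply: filterS2 ae4 ae3 => w.
  by apply: filterS3 ae12 ae34 aetau => w [h1 h2] [h3 h4] h5; split.
have weakL : {ae P, forall w, forall n f,
    wn (cocycle L s n w f) <= C (iter n s w) * wn f}.
  apply: filterS2 ae_good (ae_iter ms Ps aeWB) => w gw wb n f.
  exact: (L_weak sK wnD wnZ linL tau'0 tau'_cvg f gw (wb n)).
have [[F0 [mF0 aeF0]] ae_dec] :=
  splitting_decay ms Ps wnD wnZ I_lin I_wn Ie linL aeI weakL aeCs splitting.
have acimF0 := acim_of_equivariant sK sinvK ms msinv Ps wnJ I_lin CI0 negpP negp_ge0
  negp_lip Ie NNe linL ae_good ae_dec mF0 aeF0.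
split.
  exists F0; split=> // G acimG.
  exact: (acim_unique sK ms msinv Ps wnD wnZ wn_eq0 wnJ I_lin du linL ae_good ae_dec acimF0 acimG).
have [M [N [K [A [M_gt0 mA PA hA]]]]] := contraction_set sK ms msinv Ps ergs wnD wnZ wnJ
  I_lin nets du mL linL bL mLk linLk bLk malpha alpha0 B0 tau'0 tau'_cvg ae_good ae_dec.
have uniq k (Kk : (K <= k)%N) F G : acim P sinv I NN (Lk k) F ->
    acim P sinv I NN (Lk k) G -> {ae P, forall w, G w = F w}.
  exact: (acim_k_unique sK sinvK ms msinv Ps ergs I_lin du linLk ae_good M_gt0 mA PA hA Kk).
have ex k (Kk : (K <= k)%N) := acim_k_exists sK sinvK ms msinv Ps ergs wnJ I_lin I_wn CI0
  negpP negp_lip Ie NNe du mLk linLk bLk ae_good M_gt0 mA PA hA Kk.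
exists K; split.
  by move=> k Kk; have [Fk [acimFk _]] := ex k Kk; exists Fk; split=> // G; exact: uniq.
move=> F Fk acimF acimFk.
(* The given [Fk] is arbitrary; uniqueness identifies it almost surely with the constructed acim,
   whose strong bound it inherits. *)
have bound k : {ae P, forall w, forall D,
    pullback_bound s sinv Lk (fun f : X => `|f|) w D -> `|Fk (K + k)%N w| <= D * `|e|}.
  have Kk := leq_addr k K; have [F' [acimF' bF']] := ex _ Kk.
  apply: filterS2 bF' (uniq _ Kk _ _ acimF' (acimFk _ Kk)) => w h eqF D sb.
  by rewrite eqF; exact: h.
have conv := acim_convergence sK ms msinv Ps wnD wnZ wnJ I_lin nets du linL mLk linLk bLk
  tau'0 tau'_cvg ae_good ae_dec acimF (fun k => acimFk _ (leq_addr k K)) bound.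
(* [conv] concerns the sequence started at [K]; the shift does not affect the limit. *)
apply: filterS conv => w; under eq_fun do rewrite addnC.
by rewrite (cvg_shiftn K (fun k => wn (F w - Fk k w))).
Qed.
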